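(* Let $X_t$ be a Lévy process of type $I_c$ with $\gamma=\int_{|y|<1}y\,\nu(dy)$, and suppose that $\|T\|<\Omega$ and that the point $x=0$ belongs to $\Delta$. Let $s>0$. Then the function $$\Psi(x,s)=(I+sB^{\star})^{-1}\Phi(0,x)$$ satisfies the relation $$\int_\Delta (sI-L_\Delta)f(x)\,d_x\Psi(x,s)=f(0)$$ for all $f\in C_\Delta$.
   Context: A Lévy process with triplet $(A,\gamma,\nu)$ (so $E e^{izX_t}=e^{-t\lambda(z)}$, $\lambda(z)=\frac12Az^2-i\gamma z-\int(e^{ixz}-1-ixz1_{|x|<1})\nu(dx)$) is of type $I_c$ if $A=0$ and $\nu$ is finite and has no atoms. $\Omega=\nu(\mathbb R)$. $\Delta=\bigcup_{k=1}^n[a_k,b_k]$ with $a_1<b_1<\dots<a_n<b_n$; $D_\Delta$ is the Banach space of continuous functions on $\Delta$ with the sup norm. On $D_\Delta$, $Tf(x)=\int_\Delta f(y)\,d_y\nu(y-x)=\int_{\{u:\,x+u\in\Delta\}}f(x+u)\,\nu(du)$ and $L_\Delta f=-\Omega f+Tf$; when $\|T\|<\Omega$, $L_\Delta$ is invertible and $B=-L_\Delta^{-1}$. $C_\Delta$ is the set of functions $g$ on $\Delta$ with $g(a_k)=g(b_k)=g'(a_k)=g'(b_k)=0$ $(1\le k\le n)$ and $g''\in L^p(\Delta)$, $p>1$. The conjugate space $D_\Delta^{\star}$ is identified with functions $g$ of bounded variation on $\Delta$ via the functional $(f,g)_\Delta=\int_\Delta f(x)\,d\overline{g(x)}$, and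 $B^{\star}$ is the conjugate operator on $D_\Delta^{\star}$. The element $\Phi(0,\cdot)\in D_\Delta^{\star}$ is $\Phi(0,\cdot)=B^{\star}\sigma$, where $\sigma(x)=-1/2$ for $x<0$ and $\sigma(x)=1/2$ for $x>0$, so that $\int_\Delta f\,d\sigma=f(0)$; equivalently $\int_\Delta f(y)\,d_y\Phi(0,y)=(Bf)(0)$ for $f\in D_\Delta$. *)

(* Defs.v *)
From HB Require Import structures.
From mathcomp Require Import all_boot all_order all_algebra.
From mathcomp Require Import complex.
From mathcomp Require Import all_classical all_reals all_analysis.
Set Implicit Arguments.
Unset Strict Implicit.
Unset Printing Implicit Defensive.
Import Order.TTheory GRing.Theory Num.Theory.
Import numFieldNormedType.Exports.
Local Open Scope classical_set_scope.
Local Open Scope ring_scope.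
Local Open Scope complex_scope.

(* R[i]^o is R[i] with the topology given by the modulus. *)
Notation cplx R := (R[i]^o).

Section complex_valued.
Context {R : realType}.

Definition modc (z : cplx R) : R := Normc.normc z.

Definition cexp (z : cplx R) : cplx R :=
  (expR (complex.Re z))%:C * (cos (complex.Im z) +i* sin (complex.Im z)).

Definition cintegral {d : measure_display} {T : measurableType d}
    (mu : {measure set T -> \bar R}) (D : set T) (f : T -> cplx R) : cplx R :=
  Rintegral mu D (fun x => complex.Re (f x)) +i*
  Rintegral mu D (fun x => complex.Im (f x)).

End complex_valued.

Section levy.
Context {R : realType}.

(* Values at negative times play no role. *)
Definition is_levy_process {d : measure_display} {W : measurableType d}
    (P : probability W R) (X : R -> {RV P >-> R}) : Prop :=
  [/\ {ae P, forall w, X 0 w = 0},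
      (forall (m : nat) (t : nat -> R) (E : nat -> set R),
         0 <= t 0%N -> (forall i, t i <= t i.+1) ->
         (forall i, measurable (E i)) ->
         P [set w | forall i, (i < m)%N -> E i (X (t i.+1) w - X (t i) w)]
         = (\prod_(i < m) P [set w | E i (X (t i.+1) w - X (t i) w)%R])%E),
      (forall (t0 t1 : R) (E : set R), 0 <= t0 -> t0 <= t1 -> measurable E ->
         P [set w | E (X t1 w - X t0 w)] = P [set w | E (X (t1 - t0) w)]),
      (forall (t e : R), 0 <= t -> 0 < e ->
         P [set w | e < `|X u w - X t w|]
           @[u --> within [set u : R | 0 <= u] (nbhs t)] --> 0%E) &
      {ae P, forall w, forall t : R, 0 <= t ->
         X u w @[u --> t^'+] --> X t w /\
         (0 < t -> cvg (X u w @[u --> t^'-]))}].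

Definition is_levy_measure (nu : {measure set R -> \bar R}) : Prop :=
  nu [set 0] = 0%E /\ (\int[nu]_x (Num.min 1 (x ^+ 2))%:E < +oo)%E.

Definition levy_exponent (A gamma : R) (nu : {measure set R -> \bar R})
    (z : R) : cplx R :=
  (A / 2 * z ^+ 2)%:C - 'i%C * (gamma * z)%:C -
  cintegral nu setT (fun x =>
    cexp ('i%C * (x * z)%:C) - 1
    - 'i%C * (x * z * \1_[set y : R | `|y| < 1] x)%:C).

Definition has_triplet {d : measure_display} {W : measurableType d}
    (P : probability W R) (X : R -> {RV P >-> R}) (A gamma : R)
    (nu : {measure set R -> \bar R}) : Prop :=
  [/\ 0 <= A, is_levy_measure nu &
      forall t z : R, 0 <= t ->
        cintegral P setT (fun w => cexp ('i%C * (z * X t w)%:C)) =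
        cexp (- (t%:C * levy_exponent A gamma nu z))].

Definition type_Ic (A : R) (nu : {measure set R -> \bar R}) : Prop :=
  [/\ A = 0, fin_num_fun nu & forall x, nu [set x] = 0%E].

End levy.

Section riemann_stieltjes.
Context {R : realType}.
Implicit Types (f g : R -> cplx R) (a b : R).

(* The points of the partition are those of a :: s, and xi gives the tags. *)
Definition tagged_partition a b (s : seq R) (xi : nat -> R) : Prop :=
  itv_partition a b s /\
  forall i, (i < size s)%N ->
    nth b (a :: s) i <= xi i <= nth b (a :: s) i.+1.

Definition mesh_lt a b (s : seq R) (e : R) : Prop :=
  forall i, (i < size s)%N -> nth b (a :: s) i.+1 - nth b (a :: s) i < e.

Definition rs_sum f g a b (s : seq R) (xi : nat -> R) : cplx R :=
  \sum_(0 <= i < size s)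
    f (xi i) * (g (nth b (a :: s) i.+1) - g (nth b (a :: s) i)).

Definition is_RS f g a b (l : cplx R) : Prop :=
  forall e : R, 0 < e -> exists2 de : R, 0 < de &
    forall s xi, tagged_partition a b s xi -> mesh_lt a b s de ->
      modc (rs_sum f g a b s xi - l) < e.

Definition RSint f g a b : cplx R := xget 0 [set l | is_RS f g a b l].

End riemann_stieltjes.

Section truncated_generator.
Context {R : realType} {n : nat}.
Variables (a b : 'I_n -> R).
Implicit Types (f g h : R -> cplx R).

Definition ordered_endpoints : Prop :=
  (forall k, a k < b k) /\ (forall j k : 'I_n, (j < k)%N -> b j < a k).

Definition Delta : set R := \bigcup_(k in [set: 'I_n]) `[a k, b k]%classic.

(* Functions on Delta are represented by functions on R; only their values on
   Delta matter. *)
Definition D_Delta : set (R -> cplx R) :=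
  [set f | {within Delta, continuous f}].

Definition supnorm f : \bar R := ereal_sup [set (modc (f x))%:E | x in Delta].

Definition opnorm (S : (R -> cplx R) -> R -> cplx R) : \bar R :=
  ereal_sup [set supnorm (S f) | f in D_Delta `&` [set f | (supnorm f <= 1)%E]].

Definition RS_Delta f g : cplx R := \sum_(k < n) RSint f g (a k) (b k).

Definition pairing f g : cplx R := RS_Delta f (fun x => (g x)^*).

(* Bounded variation is required on each component of Delta, for the real and
   imaginary parts. *)
Definition Dstar : set (R -> cplx R) :=
  [set g | forall k,
     bounded_variation (a k) (b k) (fun x => complex.Re (g x)) /\
     bounded_variation (a k) (b k) (fun x => complex.Im (g x))].

(* Equality in Dstar: g and h induce the same functional on D_Delta (they may
   differ by a constant on each component, or at interior points). *)
Definition Dstar_eq g h : Prop :=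
  forall f, D_Delta f -> pairing f g = pairing f h.

(* At 0 the value is irrelevant if 0 is interior to Delta; at an endpoint it is
   chosen so that the jump is seen by the integral over Delta. *)
Definition sigma (x : R) : cplx R :=
  if x < 0 then (- 2^-1)%:C
  else if 0 < x then (2^-1)%:C
  else if [exists k, a k == 0] then (- 2^-1)%:C else (2^-1)%:C.

Definition has_deriv_on f (x : R) (l : cplx R) : Prop :=
  (f y - f x) / (y - x)%:C @[y --> within Delta x^'] --> l.

Definition in_Lp (p : R) h : Prop :=
  [/\ measurable_fun Delta (fun x => complex.Re (h x)),
      measurable_fun Delta (fun x => complex.Im (h x)) &
      (\int[lebesgue_measure]_(x in Delta) (modc (h x) `^ p)%:E < +oo)%E].

(* g1 is g', and h is g'': that is, g' is absolutely continuous on each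
   component, with derivative h in L^p. *)
Definition C_Delta (p : R) : set (R -> cplx R) :=
  [set g | exists g1 h : R -> cplx R,
    [/\ forall x, Delta x -> has_deriv_on g x (g1 x),
        forall k, [/\ g (a k) = 0, g (b k) = 0, g1 (a k) = 0 & g1 (b k) = 0],
        in_Lp p h &
        forall k x, a k <= x <= b k ->
          g1 x - g1 (a k) = cintegral lebesgue_measure `[a k, x]%classic h]].

Variable nu : {measure set R -> \bar R}.

Definition Omega : R := fine (nu setT).

Definition opT f (x : R) : cplx R :=
  cintegral nu [set u | Delta (x + u)] (fun u => f (x + u)).

Definition opL f (x : R) : cplx R := - Omega%:C * f x + opT f x.

(* B = - L^-1: B f is the element h of D_Delta such that L h = - f. *)
Definition opB f : R -> cplx R :=
  xget (fun=> 0) [set h | D_Delta h /\ forall x, Delta x -> opL h x = - f x].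

(* B^* g is the element h of Dstar such that (f, h) = (B f, g). *)
Definition Bstar g : R -> cplx R :=
  xget (fun=> 0) [set h | Dstar h /\
    forall f, D_Delta f -> pairing f h = pairing (opB f) g].

Definition Phi0 : R -> cplx R := Bstar sigma.

(* (I + s B^* )^-1 Phi0 *)
Definition Psi (s : R) : R -> cplx R :=
  xget (fun=> 0) [set g | Dstar g /\
    Dstar_eq (fun x => g x + s%:C * Bstar g x) Phi0].

End truncated_generator.

(* Main.v *)
Require Import Defs.
From HB Require Import structures.
From mathcomp Require Import all_boot all_order all_algebra.
From mathcomp Require Import complex.
From mathcomp Require Import all_classical all_reals all_analysis.
From mathcomp Require Import measurable_realfun.
From mathcomp Require Import lra ring.
Set Implicit Arguments.
Unset Strict Implicit.
Unset Printing Implicit Defensive.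
Import Order.TTheory GRing.Theory Num.Theory.
Import numFieldNormedType.Exports.
Local Open Scope classical_set_scope.
Local Open Scope ring_scope.
Local Open Scope complex_scope.

(** Write O for the total mass of nu, <f, g> for the Riemann-Stieltjes pairing
    over Delta and R_t for the inverse of t - T on the continuous functions on
    Delta. Then L = T - O and B = R_O. If psi solves
    (I + s B^* ) psi = Phi(0, .) = B^* sigma, then pairing with w = (O - T) f,
    for which B w = f, gives
      <(O - T) f, psi> + s <f, psi> = <f, sigma> = f(0),
    that is, <(s - L) f, psi> = f(0) for every continuous f, in particular for
    f in C_Delta ([C_Delta_continuous]). The equation also says
    that psi is the adjoint of R_(O+s) applied to sigma; what has to be proved
    is that all the objects exist: the integrals, B, B^* and psi.

    The kernel of the operators is real, so all this is done for real functions
    and the complex statement is read off from real and imaginary parts.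

    - Riemann-Stieltjes sums of a continuous u against a function m of bounded
      variation converge. One may take m nondecreasing, and then the integral
      is the Lebesgue integral of u composed with the generalized inverse of m
      ([nondecreasing_rs_integrable]).
    - Since nu has no atoms, T maps continuous functions to continuous
      functions ([continuous_correl]). Testing the norm of T on the constant 1
      gives nu(Delta - x) <= q < O on Delta ([truncT1_bound]). For t > q this
      makes v |-> (u + T v) / t a contraction in the sup norm, whose fixed
      point is R_t u ([resolvent_ex]); R_t is positive by the minimum principle
      ([resolvent_ge0]).
    - The adjoint of R_t acts on functions of bounded variation
      ([resolvent_adjoint_ex]). From t R_t = I + R_t T one gets
        t <R_t u, m> = <u, m> + <R_t T u, m>,
      so it is enough to represent u |-> P(T u), for a positive functional P,
      by a nondecreasing function. That function is the value of P o T on the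
      indicator of ]-oo, y] ([rint_Delta_distr]): indicators are not continuous,
      but their images under T are.
    - <f, sigma> = f(0) since sigma is nondecreasing and constant on both sides
      of its unit jump at 0 ([rint_Delta_rsigma]). *)

(** * Uniform continuity *)

Section compact_sets.
Context {R : realType}.

Lemma compact_unif_continuous (K : set R) (u : R -> R) :
  compact K -> {within K, continuous u} ->
  forall e : R, 0 < e -> exists2 d : R, 0 < d &
    forall x y, K x -> K y -> `|x - y| < d -> `|u x - u y| < e.
Proof.
move=> /compact_near_coveringP cK /subspace_continuousP cu e e0.
pose P (d x : R) := forall y, K x -> K y -> `|x - y| < d -> `|u x - u y| < e.
have [x Kx|d /= d0 dP] := cK R (0^'+) P.
  have e20 : 0 < e / 2 by rewrite divr_gt0.
  have /cvgrPdist_lt/(_ _ e20) := cu x Kx.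
  rewrite near_withinE => -[d /= d0 dP].
  exists (ball x (d / 2), [set i | 0 < i < d / 2]) => /=.
    split; first by apply: nbhsx_ballx; rewrite divr_gt0.
    exists (d / 2) => /=; first by rewrite divr_gt0.
    by move=> z /=; rewrite sub0r normrN => /ltr_normlP[_ ->] ->.
  move=> [x' i]/= [xx' /andP[i0 id]] y Kx' Ky x'y.
  have h1 : `|u x - u x'| < e / 2.
    by apply: dP => //=; rewrite /ball/= in xx' *; lra.
  have h2 : `|u x - u y| < e / 2.
    apply: dP => //=; rewrite /ball/= in xx' *.
    by rewrite (le_lt_trans (ler_distD x' _ _))//; lra.
  rewrite (le_lt_trans (ler_distD (u x) _ _))// (distrC (u x')); lra.
exists (d / 2); first by rewrite divr_gt0.
move=> x y Kx Ky xy; apply: (dP (d / 2)) => //=; last by rewrite divr_gt0.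
by rewrite sub0r normrN gtr0_norm ?divr_gt0//; lra.
Qed.

End compact_sets.

(** * Real Riemann-Stieltjes integrals *)

Section real_riemann_stieltjes.
Context {R : realType}.
Implicit Types (u v m G M : R -> R) (a b l : R).

(** Tagged partitions filtered by their mesh: Riemann-Stieltjes integrals become
    limits along a filter, and inherit the theory of limits. *)
Definition partitions a b : set_system (seq R * (nat -> R)) :=
  filter_from [set d : R | 0 < d]
    (fun d => [set p | tagged_partition a b p.1 p.2 /\ mesh_lt a b p.1 d]).

Definition rsum u m a b (p : seq R * (nat -> R)) : R :=
  \sum_(0 <= i < size p.1) u (p.2 i) *
    (m (nth b (a :: p.1) i.+1) - m (nth b (a :: p.1) i)).

Definition rint u m a b : R := lim (rsum u m a b @ partitions a b).

(** The partition into N equal steps, with N > (b - a) / d. *)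
Lemma fine_partition a b (d : R) : a < b -> 0 < d ->
  exists p : seq R * (nat -> R),
    tagged_partition a b p.1 p.2 /\ mesh_lt a b p.1 d.
Proof.
move=> ab d0; pose N := (Num.truncn ((b - a) / d)).+1.
pose x (i : nat) := a + (b - a) * (i%:R / N%:R).
have N0 : 0 < N%:R :> R by rewrite ltr0n.
have bad : (b - a) / N%:R < d.
  by rewrite ltr_pdivrMr// mulrC -ltr_pdivrMr// truncnS_gt.
pose s := mkseq (fun i => x i.+1) N.
have xE i : (i <= N)%N -> nth b (a :: s) i = x i.
  case: i => [|i] iN /=; first by rewrite /x mul0r mulr0 addr0.
  by rewrite nth_mkseq.
have xS i : x i.+1 = x i + (b - a) / N%:R.
  by rewrite /x -natr1 [in LHS](mulrDl i%:R) mul1r mulrDr addrA.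
have step0 : 0 < (b - a) / N%:R by rewrite divr_gt0// subr_gt0.
exists (s, x) => /=; rewrite /mesh_lt /tagged_partition size_mkseq.
split; last first.
  by move=> i iN; rewrite !xE// 1?ltnW// xS; lra.
split.
  split.
    apply/(pathP b) => i; rewrite size_mkseq => iN.
    by rewrite -[nth _ s i]/(nth b (a :: s) i.+1) !xE// 1?ltnW// xS; lra.
  rewrite -nth_last size_mkseq nth_mkseq// -[N.-1.+1]/N /x.
  by rewrite (divff (lt0r_neq0 N0)) mulr1 addrC subrK.
by move=> i iN; rewrite !xE// 1?ltnW// xS; lra.
Qed.

#[global] Instance partitions_filter a b : Filter (partitions a b).
Proof.
apply: filter_from_filter; first by exists 1 => /=.
move=> d e /= d0 e0; exists (Num.min d e); first by rewrite /= lt_min d0.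
by move=> [s xi] /= [tp me]; split; split=> // i /me; rewrite lt_min => /andP[].
Qed.

Lemma partitions_proper a b : a < b -> ProperFilter (partitions a b).
Proof.
move=> ab; apply: filter_from_proper => d /= d0; exact: fine_partition.
Qed.

Lemma near_partitions a b : \forall p \near partitions a b,
  tagged_partition a b p.1 p.2.
Proof. by exists 1 => //= p []. Qed.

Lemma tagged_partition_in a b s xi i : tagged_partition a b s xi ->
  (i < size s)%N ->
  [/\ a <= nth b (a :: s) i, nth b (a :: s) i <= xi i,
      xi i <= nth b (a :: s) i.+1 & nth b (a :: s) i.+1 <= b].
Proof.
move=> [ps tg] is_; have /andP[h1 h2] := tg i is_; split=> //.
  by apply: itv_partition_nth_ge ps; rewrite ltnW.
by apply: itv_partition_nth_le ps.
Qed.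

(** G plays the part of the indefinite integral of u against dm, and M controls
    the error in a way that is additive over the partition, so that the errors
    telescope. All the integrals of this file are computed in this way. *)
Lemma rsum_cvg u m G M a b :
  (forall e : R, 0 < e -> exists2 d : R, 0 < d & forall x y t,
    a <= x -> x <= t -> t <= y -> y <= b -> y - x < d ->
    `|u t * (m y - m x) - (G y - G x)| <= e * (M y - M x)) ->
  rsum u m a b @ partitions a b --> G b - G a.
Proof.
move=> H; apply/cvgrPdist_le => /= e e0.
pose c : R := `|M b - M a| + 1.
have c0 : 0 < c by rewrite ltr_wpDl.
have [|d d0 Hd] := H (e / c); first by rewrite divr_gt0.
exists d => // -[s xi] /= [tp me]; have [ps _] := tp.
have telE (F : R -> R) : F b - F a =
    \sum_(0 <= i < size s) (F (nth b (a :: s) i.+1) - F (nth b (a :: s) i)).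
  rewrite (telescope_sumr (F \o nth b (a :: s)) (leq0n _)) /comp.
  by rewrite (itv_partition_nth_size b ps).
rewrite telE distrC /rsum -sumrB (le_trans (ler_norm_sum _ _ _))//.
rewrite (@le_trans _ _ (e / c * (M b - M a)))//.
  rewrite telE mulr_sumr big_nat [leRHS]big_nat; apply: ler_sum => i /= si.
  by have [] := tagged_partition_in tp si => *; apply: Hd => //; exact: me.
have := ler_norm (M b - M a); rewrite mulrAC ler_pdivrMr// => h.
by apply: ler_wpM2l; [exact: ltW|rewrite (le_trans h)// /c lerDl].
Qed.

Lemma cvg_rint u m a b l : a < b ->
  rsum u m a b @ partitions a b --> l -> rint u m a b = l.
Proof. by move=> ab ul; have := partitions_proper ab => ?; exact/cvg_lim. Qed.

Definition rs_integrable u m a b := cvg (rsum u m a b @ partitions a b).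

Lemma rsumDl u v m a b : rsum (fun x => u x + v x) m a b =
  (fun p => rsum u m a b p + rsum v m a b p).
Proof.
by apply/funext => p; rewrite -big_split; apply: eq_bigr => i _; rewrite mulrDl.
Qed.

Lemma rsumZl c u m a b :
  rsum (fun x => c * u x) m a b = (fun p => c * rsum u m a b p).
Proof.
by apply/funext => p; rewrite mulr_sumr; apply: eq_bigr => i _; rewrite mulrA.
Qed.

Lemma rsumDr u m v a b : rsum u (fun x => m x + v x) a b =
  (fun p => rsum u m a b p + rsum u v a b p).
Proof.
by apply/funext => p; rewrite -big_split; apply: eq_bigr => i _ /=; ring.
Qed.

Lemma rsumZr c u m a b :
  rsum u (fun x => c * m x) a b = (fun p => c * rsum u m a b p).
Proof.
by apply/funext => p; rewrite mulr_sumr; apply: eq_bigr => i _ /=; ring.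
Qed.

Lemma rint_cvgD u v m a b : a < b -> rs_integrable u m a b ->
  rs_integrable v m a b ->
  rsum (fun x => u x + v x) m a b @ partitions a b -->
    rint u m a b + rint v m a b.
Proof.
move=> ab iu iv; have ? := partitions_proper ab.
by rewrite rsumDl; exact: cvgD.
Qed.

Lemma rint_cvgZ c u m a b : a < b -> rs_integrable u m a b ->
  rsum (fun x => c * u x) m a b @ partitions a b --> c * rint u m a b.
Proof.
move=> ab iu; have ? := partitions_proper ab.
by rewrite rsumZl; apply: cvgM => //; exact: cvg_cst.
Qed.

Lemma rint_cvgDr u m v a b : a < b -> rs_integrable u m a b ->
  rs_integrable u v a b ->
  rsum u (fun x => m x + v x) a b @ partitions a b -->
    rint u m a b + rint u v a b.
Proof.
move=> ab iu iv; have ? := partitions_proper ab.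
by rewrite rsumDr; exact: cvgD.
Qed.

Lemma rint_cvgZr c u m a b : a < b -> rs_integrable u m a b ->
  rsum u (fun x => c * m x) a b @ partitions a b --> c * rint u m a b.
Proof.
move=> ab iu; have ? := partitions_proper ab.
by rewrite rsumZr; apply: cvgM => //; exact: cvg_cst.
Qed.

Lemma near_eq_rsum u v m m' a b :
  (forall x, a <= x <= b -> u x = v x) ->
  (forall x, a <= x <= b -> m x = m' x) ->
  \forall p \near partitions a b, rsum u m a b p = rsum v m' a b p.
Proof.
move=> uv mm'; near=> p.
have tp : tagged_partition a b p.1 p.2 by near: p; exact: near_partitions.
rewrite /rsum !big_nat; apply: eq_bigr => i /= si.
have [h1 h2 h3 h4] := tagged_partition_in tp si.
by rewrite uv ?mm' //; apply/andP; split; lra.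
Unshelve. all: by end_near. Qed.

Lemma eq_rint_cvg u v m m' a b l : a < b ->
  (forall x, a <= x <= b -> u x = v x) ->
  (forall x, a <= x <= b -> m x = m' x) ->
  rsum u m a b @ partitions a b --> l -> rsum v m' a b @ partitions a b --> l.
Proof.
move=> ab uv mm'; have ? := partitions_proper ab.
by apply: cvg_trans; apply: near_eq_cvg; exact: near_eq_rsum.
Qed.

Lemma rint_ge0 u m a b : a < b -> rs_integrable u m a b ->
  {in `[a, b] &, {homo m : x y / x <= y}} ->
  (forall x, a <= x <= b -> 0 <= u x) -> 0 <= rint u m a b.
Proof.
move=> ab iu ndm u0; have ? := partitions_proper ab.
apply: limr_ge => //; near=> p.
have tp : tagged_partition a b p.1 p.2 by near: p; exact: near_partitions.
rewrite /rsum big_nat sumr_ge0// => i /= si.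
have [h1 h2 h3 h4] := tagged_partition_in tp si.
apply: mulr_ge0; first by apply: u0; apply/andP; split; lra.
by rewrite subr_ge0 ndm// ?in_itv/=; try apply/andP; try split; lra.
Unshelve. all: by end_near. Qed.

Section monotone.
Variables (u m : R -> R) (a b : R).
Hypotheses (ab : a < b) (cu : {within `[a, b], continuous u})
  (ndm : {in `[a, b] &, {homo m : x y / x <= y}}).

(* The generalized inverse of m. The point b keeps S t nonempty for t > m b, so
   that g is monotone, hence measurable, on the whole line. *)
Let S (t : R) := [set x | x = b \/ (a <= x <= b /\ t <= m x)].

Let g (t : R) := inf (S t).

Let Sab t x : S t x -> a <= x <= b.
Proof. by case=> [->|[]//]; rewrite lexx ltW. Qed.

Let S_inf t : has_inf (S t).
Proof. by split; [exists b; left|exists a => x /Sab /andP[]]. Qed.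

Let gab t : a <= g t <= b.
Proof.
apply/andP; split; last by apply: ge_inf; [case: (S_inf t)|left].
by apply: lb_le_inf; [case: (S_inf t)|move=> x /Sab /andP[]].
Qed.

Let ndg : {homo g : x y / x <= y}.
Proof.
move=> x y xy; apply: lb_le_inf; first by case: (S_inf y).
move=> z Sz; apply: ge_inf; first by case: (S_inf x).
by case: Sz => [->|[? yz]]; [left|right; split=> //; exact: le_trans yz].
Qed.

Let g_between x y t : a <= x -> x <= y -> y <= b -> m x < t -> t <= m y ->
  x <= g t <= y.
Proof.
move=> ax xy yb xt ty; apply/andP; split.
  apply: lb_le_inf; first by case: (S_inf t).
  move=> z [->|[zab tz]]; first by lra.
  rewrite leNgt; apply/negP => zx; move: xt; apply/negP; rewrite -leNgt.
  apply: (le_trans tz); apply: ndm; rewrite ?in_itv//= ?ax/=; lra.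
by apply: ge_inf; [case: (S_inf t)|right; split=> //; rewrite (le_trans ax)].
Qed.

Let J := `]m a, m b]%classic.

Let ug_bounded : exists c, forall t, `|u (g t)| <= c.
Proof.
have [x _ hx] := EVT_max (ltW ab) cu; have [y _ hy] := EVT_min (ltW ab) cu.
exists (`|u x| + `|u y|) => t.
have gt : g t \in `[a, b] by rewrite in_itv/= gab.
have := hx _ gt; have := hy _ gt.
have := ler_norm (u x); have := ler_norm (- u y); rewrite normrN.
have := normr_ge0 (u x); have := normr_ge0 (u y).
by rewrite ler_norml => *; apply/andP; split; lra.
Qed.

Let measurable_ug D : measurable D -> measurable_fun D (u \o g).
Proof.
move=> mD; apply: (@measurable_comp _ _ _ _ _ _ `[a, b]%classic) => //=.
- by move=> _ [t _ <-] /=; rewrite in_itv/= gab.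
- exact: subspace_continuous_measurable_fun.
- exact: nondecreasing_measurable.
Qed.

Let integrable_ug x y :
  lebesgue_measure.-integrable `]x, y]%classic (EFin \o (u \o g)).
Proof.
have [c hc] := ug_bounded.
apply: measurable_bounded_integrable => //.
- by rewrite /= lebesgue_measure_itv/=; case: ifPn => _; rewrite -?EFinB ltry.
- exact: measurable_ug.
- exists c; split; first by rewrite num_real.
  by move=> z cz t _ /=; rewrite (le_trans (hc t))// ltW.
Qed.

(** With g the generalized inverse of m, the integral of u against dm becomes
    the Lebesgue integral of u o g over ]m a, m b]. *)
Lemma nondecreasing_rs_integrable : rs_integrable u m a b.
Proof.
pose G x := \int[lebesgue_measure]_(t in `]m a, m x]) u (g t).
suff h : rsum u m a b @ partitions a b --> G b - G a.
  by apply/cvg_ex; exists (G b - G a).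
apply: (@rsum_cvg _ _ _ m) => e e0.
have [d d0 ud] := compact_unif_continuous (@segment_compact _ a b) cu e0.
exists d => // x y t ax xt ty yb yxd.
have xab : x \in `[a, b] by rewrite in_itv/= ax/=; lra.
have yab : y \in `[a, b] by rewrite in_itv/= yb andbT; lra.
have mxy : m x <= m y by apply: ndm => //; lra.
have max : m a <= m x by apply: ndm => //; rewrite in_itv/= lexx ltW.
rewrite /G Rintegral_itvB//.
have lebE : fine (lebesgue_measure `]m x, m y]%classic) = m y - m x.
  rewrite lebesgue_measure_itv/=; case: ifPn => //=.
  rewrite lte_fin -leNgt => yx.
  by apply/eqP; rewrite eq_sym subr_eq0 eq_le yx mxy.
have mI : measurable `]m x, m y]%classic by [].
have cstI c : lebesgue_measure.-integrable `]m x, m y]%classic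
    (EFin \o (fun _ => c : R)).
  apply: measurable_bounded_integrable => //.
    by rewrite /= lebesgue_measure_itv/=; case: ifPn => _; rewrite -?EFinB ltry.
  exists `|c|; split; first by rewrite num_real.
  by move=> z cz ? _ /=; rewrite ltW.
rewrite -lebE -!Rintegral_cst// -RintegralB//.
have iD : lebesgue_measure.-integrable `]m x, m y]%classic
    (EFin \o (fun s => u t - u (g s))).
  rewrite (_ : EFin \o _ = (EFin \o (fun _ => u t)) \- (EFin \o (u \o g)))%E//.
  by apply: integrableB => //; exact: integrable_ug.
apply: (le_trans (le_normr_Rintegral _ _)) => //.
apply: le_Rintegral => //.
  exact: (integrable_abse iD).
move=> s /=; rewrite in_itv/= => /andP[xs sy].
have /andP[h1 h2] := g_between ax (le_trans xt ty) yb xs sy.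
apply/ltW/ud => /=; rewrite ?in_itv/= ?gab//; first by apply/andP; split; lra.
by rewrite ltr_norml; apply/andP; split; lra.
Qed.

End monotone.

(** By the Jordan decomposition of m. *)
Lemma bounded_variation_rs_integrable u m a b : a < b ->
  {within `[a, b], continuous u} -> bounded_variation a b m ->
  rs_integrable u m a b.
Proof.
move=> ab cu bvm; have ? := partitions_proper ab.
pose q := fine \o neg_tv a m.
have bvNm := bounded_variationN bvm; pose p := fine \o pos_tv a m.
have ndp := fine_neg_tv_nondecreasing bvNm.
have ndq := fine_neg_tv_nondecreasing bvm.
have ip : rs_integrable u p a b by exact: nondecreasing_rs_integrable.
have iq : rs_integrable u q a b by exact: nondecreasing_rs_integrable.
apply/cvg_ex; exists (rint u p a b + - 1 * rint u q a b).
apply: (eq_rint_cvg (m := fun x => p x + - 1 * q x) (u := u)) => //.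
  move=> x xab; rewrite mulN1r.
  by have := bounded_variation_pos_neg_tvE bvm; move=> ->//; rewrite in_itv.
rewrite rsumDr rsumZr.
by apply: cvgD => //; apply: cvgM => //; exact: cvg_cst.
Qed.

End real_riemann_stieltjes.

(** * Integration of translates against a finite atomless measure *)

Section convolution.
Context {R : realType}.
Variable nu : {measure set R -> \bar R}.
Hypothesis nu_fin : fin_num_fun nu.
Hypothesis nu_pt : forall x, nu [set x] = 0%E.
Implicit Types (f g u v w : R -> R) (s : seq R) (a c x y z : R).

(** The cross-correlation of f with nu. Extended by 0 outside Delta, f need not
    be continuous, so the natural domain is [tame] below. *)
Definition correl f (x : R) : R := Rintegral nu setT (fun w : R => f (x + w)).

Definition tame f := [/\ measurable_fun setT f,
  exists c, forall x, `|f x| <= c &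
  exists s, forall x, x \notin s -> {for x, continuous f}].

Lemma measurable_shift f x : measurable_fun setT f ->
  measurable_fun setT (fun w : R => f (x + w)).
Proof. by move=> mf; apply: measurableT_comp => //; exact: measurable_funD. Qed.

Lemma bounded_nu_integrable f c : measurable_fun setT f ->
  (forall x, `|f x| <= c) -> nu.-integrable setT (EFin \o f).
Proof.
move=> mf fc; apply: measurable_bounded_integrable => //.
  by rewrite ltey_eq nu_fin.
exists c; split; first by rewrite num_real.
by move=> z cz t _ /=; rewrite (le_trans (fc t))// ltW.
Qed.

Lemma tame_integrable f x : tame f ->
  nu.-integrable setT (EFin \o (fun w : R => f (x + w))).
Proof.
move=> [mf [c fc] _]; apply: (@bounded_nu_integrable _ c) => //.
exact: measurable_shift.
Qed.

Lemma tame_cst c : tame (fun=> c).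
Proof.
split; [exact: measurable_cst| |].
  by exists `|c|.
by exists [::] => x _; exact: cvg_cst.
Qed.

Lemma tameD f g : tame f -> tame g -> tame (fun x => f x + g x).
Proof.
move=> [mf [c fc] [s fs]] [mg [d gd] [t gt]]; split.
- exact: measurable_funD.
- by exists (c + d) => x; rewrite (le_trans (ler_normD _ _))// lerD.
- exists (s ++ t) => x; rewrite mem_cat negb_or => /andP[xs xt].
  by apply: cvgD; [exact: fs|exact: gt].
Qed.

Lemma tameZ a f : tame f -> tame (fun x => a * f x).
Proof.
move=> [mf [c fc] [s fs]]; split.
- exact: measurable_funM.
- by exists (`|a| * c) => x; rewrite normrM ler_wpM2l.
- by exists s => x xs; apply: cvgM; [exact: cvg_cst|exact: fs].
Qed.

Lemma correlD f g x : tame f -> tame g ->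
  correl (fun z => f z + g z) x = correl f x + correl g x.
Proof.
by move=> tf tg; rewrite /correl RintegralD//; exact: tame_integrable.
Qed.

Lemma correlZ a f x : tame f -> correl (fun z => a * f z) x = a * correl f x.
Proof. by move=> tf; rewrite /correl RintegralZl//; exact: tame_integrable. Qed.

Lemma le_correl f g x : tame f -> tame g -> (forall z, f z <= g z) ->
  correl f x <= correl g x.
Proof.
by move=> tf tg fg; apply: le_Rintegral => //; exact: tame_integrable.
Qed.

Lemma negligible_seq s x : nu.-negligible [set w : R | x + w \in s].
Proof.
elim: s => [|y s ih]; first by apply: (negligibleS _ (negligible_set0 nu)).
apply: (@negligibleS _ _ _ _ ([set y - x] `|` [set w : R | x + w \in s])).
  move=> w /=; rewrite inE => /orP[/eqP <-|]; last by right.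
  by left; rewrite addrC addKr.
apply: negligibleU => //; apply/negligibleP => //; exact: nu_pt.
Qed.

Lemma eq_correl f g s x : tame f -> tame g ->
  (forall z, z \notin s -> f z = g z) ->
  correl f x = correl g x.
Proof.
move=> [mf _ _] [mg _ _] fg; rewrite /correl /Rintegral; congr fine.
apply: ae_eq_integral => //.
- by apply/measurable_EFinP; exact: measurable_shift.
- by apply/measurable_EFinP; exact: measurable_shift.
- apply: (negligibleS _ (negligible_seq s x)) => w /= H.
  by apply: contrapT => /negP xw; apply: H => _; rewrite fg.
Qed.

(** The jumps of f are only seen from x by a finite set of w, which the
    atomless measure nu ignores. *)
Lemma continuous_correl f : tame f -> continuous (correl f).
Proof.
move=> tf x; apply/(@cvg_nbhsP R R^o) => u ux; have [mf [c fc] [s fs]] := tf.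
have [|||||_ _ h] := @dominated_convergence _ _ _ nu setT measurableT
    (fun n (w : R) => (f (u n + w))%:E)
    (fun w : R => (f (x + w))%:E) (fun=> c%:E).
- by move=> n; apply/measurable_EFinP; exact: measurable_shift.
- by apply/measurable_EFinP; exact: measurable_shift.
- apply: (negligibleS _ (negligible_seq s x)) => w /= H.
  apply: contrapT => /negP xw; apply: H => _.
  apply: cvg_EFin; first by near=> n.
  apply: (@cvg_comp _ _ _ (fun n => u n + w) f _ (nbhs (x + w))).
    by apply: cvgD => //; exact: cvg_cst.
  exact: fs.
- by apply: (@bounded_nu_integrable (fun=> c) `|c|).
- by apply: aeW => w n _ /=; rewrite lee_fin.
rewrite /correl /Rintegral; apply: fine_cvg => //=.
rewrite fineK; first exact: h.
by apply: integrable_fin_num => //; exact: tame_integrable.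
Unshelve. all: by end_near. Qed.

(** * The truncated operator and its resolvent on a compact set *)

Section compact_support.
Variables (K : set R) (bK : seq R).
Hypothesis cK : compact K.
Hypothesis frK : forall x, x \notin bK -> nbhs x K \/ nbhs x (~` K).

Let mK : measurable K. Proof. exact: compact_measurable. Qed.

Notation cts u := {within K, continuous u}.

Lemma cts_bounded u : cts u ->
  exists2 c, 0 <= c & forall x, K x -> `|u x| <= c.
Proof.
move=> cu; have /ex_strict_bound_gt0[c c0 hc] : bounded_set (u @` K).
  exact/compact_bounded/continuous_compact.
by exists c; [exact: ltW|move=> x Kx; apply/ltW/hc; exists x].
Qed.

Lemma ctsD (u v : R -> R) : cts u -> cts v -> cts (fun x => u x + v x).
Proof. by move=> cu cv x; apply: cvgD; [exact: cu|exact: cv]. Qed.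

Lemma ctsZ a (u : R -> R) : cts u -> cts (fun x => a * u x).
Proof. by move=> cu x; apply: cvgM; [exact: cvg_cst|exact: cu]. Qed.

Lemma cts_cst (c : R) : cts (fun=> c).
Proof. by move=> x; exact: cvg_cst. Qed.

(** Restricting a function to [upto y] multiplies it by the indicator of
    ]-oo, y] on K. *)
Definition upto (y : R) := K `&` [set z | z <= y].

(** Away from its frontier, the set S does not create discontinuities. *)
Lemma tame_restrict (u : R -> R) S s : cts u -> S `<=` K -> measurable S ->
  (forall x, x \notin s -> nbhs x S \/ nbhs x (~` S)) -> tame (u \_ S).
Proof.
move=> cu SK mS bS; split.
- apply/(measurable_restrictT u mS).
  have mu : measurable_fun K u by exact: subspace_continuous_measurable_fun.
  exact: measurable_funS mu.
- have [c c0 uc] := cts_bounded cu; exists c => x; rewrite patchE.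
  by case: ifPn => [/set_mem/SK/uc//|_]; rewrite normr0.
- exists s => x /bS [nS|nS].
    have Sx := nbhs_singleton nS.
    move/subspace_continuousP/(_ _ (SK _ Sx)) : cu => cu.
    apply/cvgrPdist_lt => e e0; rewrite patchE mem_set//.
    move/cvgrPdist_lt/(_ _ e0) : cu; rewrite near_withinE => cu.
    near=> z; have Sz : S z by near: z.
    by rewrite patchE mem_set//; have := SK _ Sz; near: z.
  have nSx := nbhs_singleton nS.
  apply: cvg_near_cst; rewrite patchE memNset//.
  by near=> z; rewrite patchE memNset//; near: z.
Unshelve. all: by end_near. Qed.

Lemma tame_upto u y : cts u -> tame (u \_ (upto y)).
Proof.
move=> cu; apply: (@tame_restrict _ _ (y :: bK)) => //.
- by move=> z [].
- by apply: measurableI => //; rewrite -set_itvNyc.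
- move=> x; rewrite inE negb_or => /andP[xy /frK[nK|nK]]; last first.
    by right; apply: filterS nK => z nKz [].
  have [{}xy|{}yx|xy'] := ltgtP x y; last by rewrite xy' eqxx in xy.
    left; apply: filterI => //.
    by apply: filterS (lt_nbhsl xy) => z /ltW.
  right; apply: filterS (lt_nbhsr yx) => z /= yz [_ /=].
  by rewrite leNgt yz.
Qed.

Lemma tame_K u : cts u -> tame (u \_ K).
Proof. by move=> cu; exact: (@tame_restrict _ _ bK). Qed.

Definition truncT u := correl (u \_ K).

Lemma cts_truncT u : cts u -> cts (truncT u).
Proof. by move=> cu; apply/continuous_subspaceT/continuous_correl/tame_K. Qed.

Lemma truncTD u v x : cts u -> cts v ->
  truncT (fun z => u z + v z) x = truncT u x + truncT v x.
Proof.
move=> cu cv; rewrite /truncT -correlD; [|exact: tame_K..].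
congr correl; apply/funext => z.
by rewrite !patchE; case: ifPn; rewrite ?addr0.
Qed.

Lemma truncTZ a u x : cts u -> truncT (fun z => a * u z) x = a * truncT u x.
Proof.
move=> cu; rewrite /truncT -correlZ; last exact: tame_K.
congr correl; apply/funext => z.
by rewrite !patchE; case: ifPn; rewrite ?mulr0.
Qed.

Lemma le_truncT u v x : cts u -> cts v -> (forall z, K z -> u z <= v z) ->
  truncT u x <= truncT v x.
Proof.
move=> cu cv uv; apply: le_correl; [exact: tame_K..|].
by move=> z; rewrite !patchE; case: ifPn => // /set_mem/uv.
Qed.

Section resolvent.
Variables (q lam : R).
Hypothesis q_ge0 : 0 <= q.
Hypothesis truncT1 : forall x, K x -> truncT (fun=> 1) x <= q.
Hypothesis ltql : q < lam.

Let lam0 : 0 < lam. Proof. exact: le_lt_trans ltql. Qed.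

Lemma truncT_bound u c x : cts u -> 0 <= c -> (forall z, K z -> `|u z| <= c) ->
  K x -> `|truncT u x| <= c * q.
Proof.
move=> cu c0 uc Kx.
have h : c * truncT (fun=> 1) x <= c * q by rewrite ler_wpM2l// truncT1.
rewrite ler_norml; apply/andP; split.
  rewrite (@le_trans _ _ (- c * truncT (fun=> 1) x))//; first by lra.
  rewrite -truncTZ; last exact: cts_cst.
  apply: le_truncT => //; first by apply/ctsZ/cts_cst.
  by move=> z /uc; rewrite ler_norml mulr1 => /andP[].
rewrite (le_trans _ h)// -truncTZ; last exact: cts_cst.
apply: le_truncT => //; first by apply/ctsZ/cts_cst.
by move=> z /uc; rewrite ler_norml mulr1 => /andP[].
Qed.

(** At a minimum x of v with v(x) < 0 one would have
    lam v(x) >= (T v)(x) >= v(x) (T 1)(x) >= q v(x), while q < lam. *)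
Lemma resolvent_ge0 v : cts v ->
  (forall x, K x -> 0 <= lam * v x - truncT v x) -> forall x, K x -> 0 <= v x.
Proof.
move=> cv v0 x Kx; have K0 : K !=set0 by exists x.
have [y /set_mem Ky hy] := compact_EVT_min K0 cK cv.
rewrite (le_trans _ (hy x (mem_set Kx)))// leNgt; apply/negP => vy.
have h1 : v y * truncT (fun=> 1) y <= truncT v y.
  rewrite -truncTZ; last exact: cts_cst.
  apply: le_truncT => //; first by apply/ctsZ/cts_cst.
  by move=> z Kz; rewrite mulr1 hy// mem_set.
have h2 := v0 y Ky.
have h3 : v y * q <= v y * truncT (fun=> 1) y.
  by rewrite ler_wnM2l// ?truncT1// ltW.
have : lam * v y < q * v y by rewrite ltr_nM2r.
by lra.
Qed.

Lemma resolvent_uniq v w : cts v -> cts w ->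
  (forall x, K x -> lam * v x - truncT v x = lam * w x - truncT w x) ->
  forall x, K x -> v x = w x.
Proof.
move=> cv cw vw x Kx.
have cd u1 u2 : cts u1 -> cts u2 -> cts (fun x => u1 x + -1 * u2 x).
  by move=> c1 c2; apply/ctsD/ctsZ.
have dE u1 u2 y : cts u1 -> cts u2 -> lam * (u1 y + -1 * u2 y) -
    truncT (fun x => u1 x + -1 * u2 x) y =
    (lam * u1 y - truncT u1 y) - (lam * u2 y - truncT u2 y).
  by move=> c1 c2; rewrite truncTD ?truncTZ//; [ring|exact: ctsZ].
have h1 : 0 <= v x + -1 * w x.
  apply: (resolvent_ge0 (cd _ _ cv cw)) => // y Ky.
  by rewrite dE// vw// subrr.
have h2 : 0 <= w x + -1 * v x.
  apply: (resolvent_ge0 (cd _ _ cw cv)) => // y Ky.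
  by rewrite dE// vw// subrr.
by lra.
Qed.

(** The iterates v_n of [step] contract with ratio r = q / lam, so they converge
    uniformly on K, within C r^n of their limit. *)
Lemma resolvent_ex u : cts u ->
  exists v, cts v /\ forall x, K x -> lam * v x - truncT v x = u x.
Proof.
move=> cu; have [c0 c00 uc0] := cts_bounded cu.
pose r := q / lam; pose c := c0 / lam.
have li0 : 0 <= lam^-1 by rewrite invr_ge0 ltW.
have r0 : 0 <= r by rewrite divr_ge0// ltW.
have r1 : r < 1 by rewrite ltr_pdivrMr// mul1r.
have c_ge0 : 0 <= c by rewrite divr_ge0// ltW.
pose step (v : R -> R) x := lam^-1 * (u x + truncT v x).
pose v_ n := iter n step (fun=> 0).
have cv_ n : cts (v_ n).
  elim: n => [|n ih]; first exact: cts_cst.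
  by apply/ctsZ/ctsD => //; exact: cts_truncT.
have stepB v w k x : cts v -> cts w -> 0 <= k ->
    (forall z, K z -> `|v z - w z| <= k) -> K x ->
    `|step v x - step w x| <= r * k.
  move=> cv cw k0 vwk Kx.
  have -> : step v x - step w x = lam^-1 * truncT (fun z => v z + -1 * w z) x.
    by rewrite /step truncTD ?truncTZ//; [ring|exact: ctsZ].
  rewrite normrM (ger0_norm li0) /r mulrAC mulrC ler_wpM2r//.
  rewrite mulrC; apply: truncT_bound => //; first exact/ctsD/ctsZ.
  by move=> z Kz; rewrite mulN1r vwk.
have inc n x : K x -> `|v_ n.+1 x - v_ n x| <= r ^+ n * c.
  elim: n x => [|n ih] x Kx.
    rewrite /= /step (_ : truncT _ x = 0); last first.
      have := @truncTZ 0 (fun=> 0) x (@cts_cst 0); by rewrite !mul0r.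
    rewrite addr0 subr0 expr0 mul1r normrM (ger0_norm li0).
    by rewrite mulrC /c ler_wpM2r ?uc0.
  rewrite exprS -mulrA; apply: (stepB (v_ n.+1) (v_ n)) => //.
  by rewrite mulr_ge0// exprn_ge0.
pose C := c / (1 - r).
have C0 : 0 <= C by rewrite divr_ge0// subr_ge0 ltW.
have cE : c = C * (1 - r) by rewrite divfK// subr_eq0 gt_eqF.
have tail n k x : K x ->
    `|v_ (n + k)%N x - v_ n x| <= r ^+ n * C * (1 - r ^+ k).
  move=> Kx; elim: k => [|k ih].
    by rewrite addn0 subrr normr0 expr0 subrr mulr0.
  rewrite addnS (le_trans (ler_distD (v_ (n + k)%N x) _ _))//.
  rewrite (le_trans (lerD (inc _ _ Kx) ih))// cE exprD exprS.
  by rewrite le_eqVlt; apply/orP; left; apply/eqP; ring.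
have tail' n m x : K x -> (n <= m)%N -> `|v_ m x - v_ n x| <= r ^+ n * C.
  move=> Kx nm; rewrite -(subnKC nm) (le_trans (tail _ _ _ Kx))//.
  rewrite ler_piMr//; first by rewrite mulr_ge0// exprn_ge0.
  by rewrite gerBl exprn_ge0.
have geo0 e : 0 < e -> exists n, r ^+ n * C < e.
  move=> e0; have : r ^+ n * C @[n --> \oo] --> 0 * C.
    by apply: cvgM; [apply: cvg_expr; rewrite ger0_norm|exact: cvg_cst].
  rewrite mul0r => /cvgrPdist_lt/(_ _ e0) [n _ /(_ n (leqnn n))] /=.
  by rewrite sub0r normrN => h; exists n; rewrite (le_lt_trans (ler_norm _)).
pose v x := lim (v_ n x @[n --> \oo]).
have v_v x : K x -> v_ n x @[n --> \oo] --> v x.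
  move=> Kx; apply: cauchy_cvg; apply/cauchy_exP => e e0.
  have [n hn] := geo0 e e0; exists (v_ n x); exists n => // m /= nm.
  by rewrite /ball/= distrC (le_lt_trans (tail' _ _ _ Kx nm)).
have vB n x : K x -> `|v x - v_ n x| <= r ^+ n * C.
  move=> Kx; have h : `|v_ m x - v_ n x| @[m --> \oo] --> `|v x - v_ n x|.
    by apply: cvg_norm; apply: cvgB; [exact: v_v|exact: cvg_cst].
  rewrite -(cvg_lim _ h)//; apply: limr_le.
    by apply/cvg_ex; exists `|v x - v_ n x|.
  by near=> m; apply: tail' => //; near: m; exact: nbhs_infty_ge.
have cv : cts v.
  apply/subspace_continuousP => x Kx; apply/cvgrPdist_lt => e e0.
  have [|n hn] := geo0 (e / 3); first by rewrite divr_gt0.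
  have /subspace_continuousP/(_ _ Kx)/cvgrPdist_lt/(_ (e / 3)) := cv_ n.
  rewrite divr_gt0// !near_withinE => /(_ isT); apply: filterS => z hz Kz.
  have h1 := le_lt_trans (vB n x Kx) hn.
  have h2 := le_lt_trans (vB n z Kz) hn.
  have {}hz : `|v_ n x - v_ n z| < e / 3 := hz Kz.
  have -> : v x - v z = (v x - v_ n x) + (v_ n x - v_ n z) - (v z - v_ n z).
    by ring.
  have -> : e = e / 3 + e / 3 + e / 3 by field.
  rewrite (le_lt_trans (ler_normB _ _))// ltrD//.
  by rewrite (le_lt_trans (ler_normD _ _))// ltrD.
exists v; split=> // x Kx; apply/eqP; rewrite -subr_eq0 -normr_le0.
apply/ler_addgt0Pl => e e0; rewrite addr0.
have [|n hn] := geo0 (e / (2 * lam)); first by rewrite divr_gt0// mulr_gt0.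
have h1 := vB n.+1 x Kx.
have rnC : 0 <= r ^+ n * C by rewrite mulr_ge0// exprn_ge0.
have h2 := stepB v (v_ n) (r ^+ n * C) x cv (cv_ n) rnC (vB n) Kx.
have -> : lam * v x - truncT v x - u x =
    lam * ((v x - v_ n.+1 x) - (step v x - step (v_ n) x)).
  by rewrite [v_ n.+1 x]/(step (v_ n) x) /step; field; rewrite gt_eqF.
rewrite normrM gtr0_norm// mulrC -ler_pdivlMr//.
rewrite (le_trans (ler_normB _ _))//.
rewrite exprS -mulrA in h1.
have : r * (r ^+ n * C) <= r ^+ n * C by rewrite ler_piMl// ltW.
have -> : e / lam = e / (2 * lam) + e / (2 * lam) by field; rewrite gt_eqF.
by lra.
Unshelve. all: by end_near. Qed.

End resolvent.
End compact_support.
End convolution.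

(** * The real pairing over Delta *)

Section real_delta.
Context {R : realType} {n : nat}.
Variables (a b : 'I_n -> R).
Hypothesis ord_ab : ordered_endpoints a b.
Implicit Types (u v m : R -> R) (c x y z : R).

Notation K := (Delta a b).
Notation cts u := {within K, continuous u}.

Let ab k : a k < b k. Proof. by case: ord_ab. Qed.

Lemma DeltaP x : K x -> exists k, a k <= x <= b k.
Proof. by move=> [k _ /=]; rewrite in_itv/= => h; exists k. Qed.

Lemma Delta_itv k x : a k <= x <= b k -> K x.
Proof. by move=> h; exists k => //=; rewrite in_itv. Qed.

Lemma compact_Delta : compact K.
Proof.
rewrite /Delta -[X in bigcup X](_ : [set` enum 'I_n] = _); last first.
  by apply/seteqP; split=> k //= _; rewrite mem_enum.
by rewrite bigcup_seq; apply: bigsetU_compact => k _; exact: segment_compact.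
Qed.

Definition endpoints : seq R := codom a ++ codom b.

Lemma Delta_frontier x : x \notin endpoints -> nbhs x K \/ nbhs x (~` K).
Proof.
rewrite mem_cat negb_or => /andP[xa xb].
have [/DeltaP[k /andP[ax xb']]|nKx] := pselect (K x).
  left; have {}ax : a k < x.
    by rewrite lt_neqAle ax andbT; apply: contra xa => /eqP <-; exact: codom_f.
  have {}xb' : x < b k.
    by rewrite lt_neqAle xb' andbT; apply: contra xb => /eqP ->; exact: codom_f.
  apply: filterS (filterI (lt_nbhsr ax) (lt_nbhsl xb')) => z /= [az zb].
  by apply: (@Delta_itv k); rewrite !ltW.
right; apply: open_nbhs_nbhs; split=> //; apply: closed_openC.
by apply: compact_closed; [exact: Rhausdorff|exact: compact_Delta].
Qed.

Lemma cts_component u k : cts u -> {within `[a k, b k], continuous u}.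
Proof.
by apply: continuous_subspaceW => x /=; rewrite in_itv/=; exact: Delta_itv.
Qed.

Definition bv_Delta m := forall k, bounded_variation (a k) (b k) m.

Definition rint_Delta u m := \sum_(k < n) rint u m (a k) (b k).

Lemma rs_integrableD u m k : cts u -> bv_Delta m ->
  rs_integrable u m (a k) (b k).
Proof.
by move=> /(@cts_component _ k) cu bvm; exact: bounded_variation_rs_integrable.
Qed.

Lemma rint_DeltaDl u v m : cts u -> cts v -> bv_Delta m ->
  rint_Delta (fun x => u x + v x) m = rint_Delta u m + rint_Delta v m.
Proof.
move=> cu cv bvm; rewrite -big_split; apply: eq_bigr => k _.
by apply: cvg_rint => //; apply: rint_cvgD => //; exact: rs_integrableD.
Qed.

Lemma rint_DeltaZl c u m : cts u -> bv_Delta m ->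
  rint_Delta (fun x => c * u x) m = c * rint_Delta u m.
Proof.
move=> cu bvm; rewrite mulr_sumr; apply: eq_bigr => k _.
by apply: cvg_rint => //; apply: rint_cvgZ => //; exact: rs_integrableD.
Qed.

Lemma rint_DeltaDr u m1 m2 : cts u -> bv_Delta m1 -> bv_Delta m2 ->
  rint_Delta u (fun x => m1 x + m2 x) = rint_Delta u m1 + rint_Delta u m2.
Proof.
move=> cu bv1 bv2; rewrite -big_split; apply: eq_bigr => k _.
by apply: cvg_rint => //; apply: rint_cvgDr => //; exact: rs_integrableD.
Qed.

Lemma rint_DeltaZr c u m : cts u -> bv_Delta m ->
  rint_Delta u (fun x => c * m x) = c * rint_Delta u m.
Proof.
move=> cu bvm; rewrite mulr_sumr; apply: eq_bigr => k _.
by apply: cvg_rint => //; apply: rint_cvgZr => //; exact: rs_integrableD.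
Qed.

Lemma eq_rint_Delta u v m : cts u -> bv_Delta m ->
  (forall x, K x -> u x = v x) -> rint_Delta u m = rint_Delta v m.
Proof.
move=> cu bvm uv; apply: eq_bigr => k _; apply/esym/cvg_rint => //.
apply: (@eq_rint_cvg _ u v m m) => //; last exact: rs_integrableD.
by move=> x /Delta_itv; exact: uv.
Qed.

Lemma bv_DeltaD m1 m2 : bv_Delta m1 -> bv_Delta m2 ->
  bv_Delta (fun x => m1 x + m2 x).
Proof. by move=> b1 b2 k; exact: bounded_variationD. Qed.

Lemma variationZ c (x y : R) m s :
  variation x y (fun z => c * m z) s = `|c| * variation x y m s.
Proof.
rewrite /variation mulr_sumr; apply: eq_bigr => i _ /=.
by rewrite -normrM mulrBr.
Qed.

Lemma bv_DeltaZ c m : bv_Delta m -> bv_Delta (fun x => c * m x).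
Proof.
move=> bm k; have [r hr] := bm k; exists (`|c| * r) => _ [s abs <-].
by rewrite variationZ ler_wpM2l// hr//; exact: variations_variation.
Qed.

Lemma homo_bv_Delta m : {homo m : x y / x <= y} -> bv_Delta m.
Proof.
by move=> hm k; apply: nondecreasing_bounded_variation => x y _ _; exact: hm.
Qed.

Definition positive_functional (P : (R -> R) -> R) :=
  [/\ forall u v, cts u -> cts v -> P (fun x => u x + v x) = P u + P v,
      forall c u, cts u -> P (fun x => c * u x) = c * P u &
      forall u, cts u -> (forall x, K x -> 0 <= u x) -> 0 <= P u].

(** By the Jordan decomposition of m on each component of Delta. Positivity of
    the two functionals is what makes [distr] below monotone. *)
Lemma bv_Delta_positive_decomposition m : bv_Delta m -> exists P N,
  [/\ positive_functional P, positive_functional N &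
  forall u, cts u -> rint_Delta u m = P u - N u].
Proof.
move=> bvm.
have bvN k : bounded_variation (a k) (b k) (\- m) by exact: bounded_variationN.
have pos (g : 'I_n -> R -> R) :
    (forall k, {in `[a k, b k] &, {homo g k : x y / x <= y}}) ->
    positive_functional (fun u => \sum_(k < n) rint u (g k) (a k) (b k)).
  move=> ndg.
  have gi u k : cts u -> rs_integrable u (g k) (a k) (b k).
    move=> cu; apply: nondecreasing_rs_integrable => //.
    exact: cts_component.
  split.
  - move=> u v cu cv; rewrite -big_split; apply: eq_bigr => k _.
    by apply: cvg_rint => //; apply: rint_cvgD => //; exact: gi.
  - move=> c u cu; rewrite mulr_sumr; apply: eq_bigr => k _.
    by apply: cvg_rint => //; apply: rint_cvgZ => //; exact: gi.
  - move=> u cu u0; apply: sumr_ge0 => k _.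
    apply: rint_ge0 => //; first exact: gi.
    by move=> x /Delta_itv; exact: u0.
pose p k := fine \o pos_tv (a k) m; pose q k := fine \o neg_tv (a k) m.
have ndp k : {in `[a k, b k] &, {homo p k : x y / x <= y}}.
  exact: fine_neg_tv_nondecreasing.
have ndq k : {in `[a k, b k] &, {homo q k : x y / x <= y}}.
  exact: fine_neg_tv_nondecreasing.
exists (fun u => \sum_(k < n) rint u (p k) (a k) (b k)).
exists (fun u => \sum_(k < n) rint u (q k) (a k) (b k)).
split; [exact: pos|exact: pos|move=> u cu].
rewrite -sumrB; apply: eq_bigr => k _; apply: cvg_rint => //.
have cuk := @cts_component u k cu.
have bp : bounded_variation (a k) (b k) (p k).
  exact: nondecreasing_bounded_variation.
have bq : bounded_variation (a k) (b k) (q k).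
  exact: nondecreasing_bounded_variation.
have ip := bounded_variation_rs_integrable (ab k) cuk bp.
have iq := bounded_variation_rs_integrable (ab k) cuk bq.
have ? := partitions_proper (ab k).
apply: (eq_rint_cvg (u := u) (m := fun x => p k x + - 1 * q k x)) => //.
  move=> x xab; rewrite mulN1r.
  by have := bounded_variation_pos_neg_tvE (bvm k); move=> ->//; rewrite in_itv.
rewrite rsumDr rsumZr -[- rint _ _ _ _]mulN1r.
by apply: cvgD => //; apply: cvgM => //; exact: cvg_cst.
Qed.

Lemma eq_positive P u v : positive_functional P -> cts u -> cts v ->
  (forall x, K x -> u x = v x) -> P u = P v.
Proof.
move=> [PD PZ P0] cu cv uv.
have h w1 w2 : cts w1 -> cts w2 -> (forall x, K x -> w1 x = w2 x) ->
    P w2 <= P w1.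
  move=> c1 c2 w12; have := P0 (fun x => w1 x + -1 * w2 x).
  rewrite PD ?PZ//; last exact: ctsZ.
  move=> H; have : 0 <= P w1 + -1 * P w2; last by lra.
  by apply: H => [|x Kx]; [exact/ctsD/ctsZ|rewrite w12// mulN1r subrr].
by apply/eqP; rewrite eq_le !h// => x Kx; rewrite uv.
Qed.

Lemma positive_le P u v : positive_functional P -> cts u -> cts v ->
  (forall x, K x -> u x <= v x) -> P u <= P v.
Proof.
move=> [PD PZ P0] cu cv uv; have := P0 (fun x => v x + -1 * u x).
rewrite PD ?PZ//; last exact: ctsZ.
move=> H; have : 0 <= P v + -1 * P u; last by lra.
by apply: H => [|x Kx]; [exact/ctsD/ctsZ|have := uv x Kx; lra].
Qed.

Lemma cts_sum (I : Type) (r : seq I) (F : I -> R -> R) :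
  (forall i, cts (F i)) ->
  cts (fun x => \sum_(i <- r) F i x).
Proof.
move=> cF; elim: r => [|i r ih].
  by under eq_fun do rewrite big_nil; exact: cts_cst.
by under eq_fun do rewrite big_cons; exact: ctsD.
Qed.

Lemma positive_sum P (I : Type) (r : seq I) (F : I -> R -> R) :
  positive_functional P -> (forall i, cts (F i)) ->
  P (fun x => \sum_(i <- r) F i x) = \sum_(i <- r) P (F i).
Proof.
move=> [PD PZ P0] cF; elim: r => [|i r ih].
  under eq_fun do rewrite big_nil; rewrite big_nil.
  have := PZ 0 (fun=> 0) (@cts_cst _ _ 0); by rewrite !mul0r.
under eq_fun do rewrite big_cons; rewrite big_cons PD ?ih//.
exact: cts_sum.
Qed.

(** * The adjoint of the resolvent *)

Section measure.
Variable nu : {measure set R -> \bar R}.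
Hypothesis nu_fin : fin_num_fun nu.
Hypothesis nu_pt : forall x, nu [set x] = 0%E.

Notation T := (truncT nu K).

Lemma cts_T u : cts u -> cts (T u).
Proof.
move=> cu.
by have := cts_truncT nu_fin nu_pt compact_Delta Delta_frontier cu.
Qed.

Lemma cts_lamBT lam u : cts u -> cts (fun x => lam * u x - T u x).
Proof.
move=> cu; rewrite (_ : (fun x => _) = fun x => lam * u x + -1 * T u x).
  by apply/ctsD/ctsZ/cts_T => //; exact: ctsZ.
by apply/funext => x; rewrite mulN1r.
Qed.

(** T applied to u times the indicator of ]-oo, y]. *)
Definition partialT u y := correl nu (u \_ (upto K y)).

Lemma upto_restrictE u y z :
  (u \_ (upto K y)) z = if (z \in K) && (z <= y) then u z else 0.
Proof.
rewrite patchE; congr (if _ then _ else _); apply/idP/andP.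
  by move=> /set_mem[? ?]; split=> //; exact: mem_set.
by move=> [/set_mem ? ?]; apply: mem_set.
Qed.

Lemma tame_uptoD u y : cts u -> tame (u \_ (upto K y)).
Proof. exact: tame_upto compact_Delta Delta_frontier _ _. Qed.

Lemma cts_partialT u y : cts u -> cts (partialT u y).
Proof.
move=> cu; apply/continuous_subspaceT/continuous_correl => //.
exact: tame_uptoD.
Qed.

(** The half-open intervals ]a_k, b_k] cover Delta up to the left endpoints,
    which nu does not see from x. *)
Lemma sum_partialT u x : cts u ->
  \sum_(k < n) (partialT u (b k) x + -1 * partialT u (a k) x) = T u x.
Proof.
move=> cu; pose F k z := (u \_ (upto K (b k))) z + -1 * (u \_ (upto K (a k))) z.
have tF k : tame (F k) by apply: tameD; [|apply: tameZ]; exact: tame_uptoD.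
have tS (r : seq 'I_n) : tame (fun z => \sum_(k <- r) F k z).
  elim: r => [|k r ih].
    by under eq_fun do rewrite big_nil; exact: tame_cst.
  by under eq_fun do rewrite big_cons; exact: tameD.
have -> : \sum_(k < n) (partialT u (b k) x + -1 * partialT u (a k) x) =
    correl nu (fun z => \sum_(k < n) F k z) x.
  elim: (index_enum 'I_n) => [|k r ih].
    rewrite big_nil; under [X in correl nu X]eq_fun do rewrite big_nil.
    by rewrite /correl Rintegral_cst// mul0r.
  under [X in correl nu X]eq_fun do rewrite big_cons.
  rewrite big_cons ih correlD// {1}/F correlD//; try exact: tame_uptoD.
    by rewrite correlZ//; exact: tame_uptoD.
  by apply: tameZ; exact: tame_uptoD.
apply: (@eq_correl _ nu nu_pt _ _ endpoints) => //.
  exact: tame_K compact_Delta Delta_frontier _ cu.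
move=> z; rewrite mem_cat negb_or => /andP[za _].
rewrite patchE; case: ifPn => zK; last first.
  by apply: big1 => k _; rewrite /F !upto_restrictE (negPf zK)/= mulr0 addr0.
have [k /andP[az zb]] := DeltaP (set_mem zK).
have {}az : a k < z.
  by rewrite lt_neqAle az andbT; apply: contra za => /eqP <-; exact: codom_f.
rewrite (bigD1 k)//= big1 ?addr0.
  by rewrite /F !upto_restrictE zK zb/= leNgt az/= mulr0 addr0.
move=> j jk; rewrite /F !upto_restrictE zK/=.
have [_ sep] := ord_ab.
have [jk'|kj|/val_inj jk'] := ltngtP j k; last by rewrite jk' eqxx in jk.
  have := sep _ _ jk' => h; have := ab j => h'.
  by rewrite !ifF ?mulr0 ?addr0//; apply/negbTE; rewrite -ltNge; lra.
have := sep _ _ kj => h; have := ab j => h'.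
by rewrite !ifT ?mulN1r ?subrr//; lra.
Qed.

Lemma partialT_homo x y z : x <= y ->
  partialT (fun=> 1) x z <= partialT (fun=> 1) y z.
Proof.
move=> xy; apply: le_correl => //; [exact/tame_uptoD/cts_cst..|].
move=> w; rewrite !upto_restrictE; case: (w \in K) => //=.
by have [wx|wx] := leP w x; [rewrite (le_trans wx)|case: ifP].
Qed.

(** The distribution function of P o T, seen as a measure on Delta. *)
Definition distr (P : (R -> R) -> R) y := P (partialT (fun=> 1) y).

Lemma distr_homo P : positive_functional P -> {homo distr P : x y / x <= y}.
Proof.
move=> pP x y xy; apply: positive_le => //; [exact/cts_partialT/cts_cst..|].
by move=> z _; exact: partialT_homo.
Qed.

(** The indefinite integral of u against the measure P o T is
    y |-> P (partialT u y). Over a short interval ]x, y] the function u stays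
    within e of u t, and since P o T is positive the error is at most e times
    the increment of [distr P]. *)
Lemma distr_rsum_cvg P u k : positive_functional P -> cts u ->
  rsum u (distr P) (a k) (b k) @ partitions (a k) (b k) -->
    P (partialT u (b k)) - P (partialT u (a k)).
Proof.
move=> pP cu; have [PD PZ _] := pP.
apply: (@rsum_cvg _ _ _ (fun y => P (partialT u y)) (distr P)) => e e0.
have [d d0 ud] := compact_unif_continuous compact_Delta cu e0.
exists d => // x y t ax xt ty yb yxd.
have Kt : K t by apply: (@Delta_itv k); apply/andP; split; lra.
have c1 : cts (fun=> 1 : R) by exact: cts_cst.
pose dif v z := partialT v y z + -1 * partialT v x z.
have cdif v : cts v -> cts (dif v).
  by move=> cv; apply: ctsD; [|apply: ctsZ]; exact: cts_partialT.
have Pdif v : cts v -> P (dif v) = P (partialT v y) - P (partialT v x).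
  move=> cv; rewrite PD ?PZ ?mulN1r//; try exact: cts_partialT.
  by apply: ctsZ; exact: cts_partialT.
pose phi v z := (v \_ (upto K y)) z + -1 * (v \_ (upto K x)) z.
have tphi v : cts v -> tame (phi v).
  by move=> cv; apply: tameD; [|apply: tameZ]; exact: tame_uptoD.
have difE v z : cts v -> dif v z = correl nu (phi v) z.
  move=> cv; rewrite correlD ?correlZ//; try exact: tame_uptoD.
  by apply: tameZ; exact: tame_uptoD.
rewrite -!/(distr P _) -Pdif// -[distr P y - _]Pdif// -PZ; last exact: cdif.
(* Used with c = 1 and c = -1, for the two halves of the absolute value. *)
have key c : `|c| = 1 ->
    c * P (fun z => u t * dif (fun=> 1) z + -1 * dif u z) <=
    e * P (dif (fun=> 1)).
  move=> c1'; have cw : cts (fun z => u t * dif (fun=> 1) z + -1 * dif u z).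
    by apply: ctsD; apply: ctsZ; exact: cdif.
  rewrite -!PZ//; [|exact: cdif].
  apply: positive_le => //; [exact: ctsZ|by apply: ctsZ; exact: cdif|].
  move=> z _; rewrite !difE// -!correlZ//; try exact: tphi.
  rewrite -correlD//; try by apply: tameZ; exact: tphi.
  rewrite -correlZ//; last by apply: tameD; apply: tameZ; exact: tphi.
  apply: le_correl => //; [|by apply: tameZ; exact: tphi|].
    by apply: tameZ; apply: tameD; apply: tameZ; exact: tphi.
  move=> w; rewrite /phi !upto_restrictE; case wK: (w \in K) => /=; last by lra.
  have [wx|xw] := leP w x; first by rewrite (le_trans wx) ?(le_trans xt)//; lra.
  have [wy|yw] := leP w y; last by lra.
  rewrite !mulr0 !addr0 !mulr1 mulN1r.
  rewrite (le_trans (ler_norm _))// normrM c1' mul1r.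
  apply/ltW/ud => //; first exact: set_mem wK.
  by rewrite ltr_norml; apply/andP; split; lra.
have -> : P (fun z => u t * dif (fun=> 1) z) - P (dif u) =
    P (fun z => u t * dif (fun=> 1) z + -1 * dif u z).
  rewrite (PD (fun z => u t * dif (fun=> 1) z) (fun z => -1 * dif u z)).
  - by rewrite [P (fun z => -1 * _)]PZ ?mulN1r//; exact: cdif.
  - by apply: ctsZ; exact: cdif.
  - by apply: ctsZ; exact: cdif.
have h1 := key 1 (normr1 _).
have h2 := key (-1) (normrN1 _).
by rewrite ler_norml; apply/andP; split; lra.
Qed.

Lemma rint_Delta_distr P u : positive_functional P -> cts u ->
  rint_Delta u (distr P) = P (T u).
Proof.
move=> pP cu; have [PD PZ _] := pP.
rewrite -(@eq_positive P (fun x =>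
    \sum_(k < n) (partialT u (b k) x + -1 * partialT u (a k) x)))//.
- rewrite positive_sum//.
    apply: eq_bigr => k _.
    rewrite (cvg_rint _ (distr_rsum_cvg (k := k) pP cu))//.
    rewrite PD ?PZ ?mulN1r//; try exact: cts_partialT.
    by apply: ctsZ; exact: cts_partialT.
  by move=> k; apply: ctsD; [|apply: ctsZ]; exact: cts_partialT.
- by apply: cts_sum => k; apply: ctsD; [|apply: ctsZ]; exact: cts_partialT.
- exact: cts_T.
- by move=> x _; exact: sum_partialT.
Qed.

Section resolvent.
Variables (q lam : R).
Hypothesis q_ge0 : 0 <= q.
Hypothesis T1 : forall x, K x -> T (fun=> 1) x <= q.
Hypothesis ltql : q < lam.

Definition resolvent u : R -> R :=
  xget (fun=> 0) [set v | cts v /\ forall x, K x -> lam * v x - T v x = u x].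

Lemma resolventP u : cts u ->
  cts (resolvent u) /\
  forall x, K x -> lam * resolvent u x - T (resolvent u) x = u x.
Proof.
move=> cu; apply: (@xgetPex _ (fun=> 0) [set v | cts v /\
  forall x, K x -> lam * v x - T v x = u x]).
exact: (resolvent_ex nu_fin nu_pt compact_Delta Delta_frontier q_ge0 T1 ltql).
Qed.

Lemma cts_resolvent u : cts u -> cts (resolvent u).
Proof. by case/resolventP. Qed.

Lemma resolventE u v : cts u -> cts v ->
  (forall x, K x -> lam * v x - T v x = u x) ->
  forall x, K x -> resolvent u x = v x.
Proof.
move=> cu cv vu; have [cr ru] := resolventP cu.
apply: (resolvent_uniq nu_fin compact_Delta Delta_frontier T1 ltql cr cv).
by move=> x Kx; rewrite ru// vu.
Qed.

Lemma positive_resolvent P : positive_functional P ->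
  positive_functional (P \o resolvent).
Proof.
move=> pP; have [PD PZ P0] := pP; split=> /=.
- move=> u v cu cv.
  have [cu' uE] := resolventP cu; have [cv' vE] := resolventP cv.
  rewrite -PD//.
  apply: eq_positive => //; [exact/cts_resolvent/ctsD|exact: ctsD|].
  apply: resolventE; [exact: ctsD|exact: ctsD|].
  move=> x Kx; rewrite (truncTD nu_fin compact_Delta Delta_frontier)//.
  by rewrite -uE// -vE//; ring.
- move=> c u cu; have [cu' uE] := resolventP cu.
  rewrite -PZ//.
  apply: eq_positive => //; [exact/cts_resolvent/ctsZ|exact: ctsZ|].
  apply: resolventE; [exact: ctsZ|exact: ctsZ|].
  move=> x Kx; rewrite (truncTZ nu_fin compact_Delta Delta_frontier)//.
  by rewrite -uE//; ring.
- move=> u cu u0; have [cu' uE] := resolventP cu; apply: P0 => //.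
  apply: (resolvent_ge0 nu_fin compact_Delta Delta_frontier T1 ltql cu').
  by move=> x Kx; rewrite uE// u0.
Qed.

(** From lam R = I + R T, with R the resolvent: m' is lam^-1 (m + h), where h
    represents u |-> rint_Delta (R (T u)) m. The term m is kept as it is,
    because the identity does not smooth indicator functions. *)
Lemma resolvent_adjoint_ex m : bv_Delta m -> exists2 m', bv_Delta m' &
  forall u, cts u ->
    rint_Delta (fun x => lam * u x - T u x) m' = rint_Delta u m.
Proof.
move=> bvm; have [P [N [pP pN mE]]] := bv_Delta_positive_decomposition bvm.
have lam0 : lam != 0 by rewrite gt_eqF// (le_lt_trans q_ge0).
have pP' := positive_resolvent pP; have pN' := positive_resolvent pN.
have bP := homo_bv_Delta (distr_homo pP').
have bN := homo_bv_Delta (distr_homo pN').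
pose h x := distr (P \o resolvent) x + -1 * distr (N \o resolvent) x.
have bh : bv_Delta h by apply/bv_DeltaD => //; exact: bv_DeltaZ.
exists (fun x => lam^-1 * (m x + h x)); first exact/bv_DeltaZ/bv_DeltaD.
move=> u cu; set w := fun x => _; have cw : cts w by exact: cts_lamBT.
have cTw := cts_T cw.
have hE : rint_Delta w h = rint_Delta (resolvent (T w)) m.
  rewrite rint_DeltaDr ?rint_DeltaZr//; last exact: bv_DeltaZ.
  by rewrite !rint_Delta_distr//= mulN1r -mE//; exact: cts_resolvent.
rewrite rint_DeltaZr//; last exact: bv_DeltaD.
rewrite rint_DeltaDr// hE -rint_DeltaDl//; last exact: cts_resolvent.
rewrite (@eq_rint_Delta _ (fun x => lam * u x))//.
- by rewrite rint_DeltaZl// mulKf.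
- by apply: ctsD => //; exact: cts_resolvent.
- move=> x Kx; rewrite (resolventE cTw (cts_T cu))//.
    by rewrite /w subrK.
  move=> z Kz; rewrite [in RHS](_ : w = fun x => lam * u x + -1 * T u x).
    rewrite (truncTD nu_fin compact_Delta Delta_frontier).
    + by rewrite !(truncTZ nu_fin compact_Delta Delta_frontier) ?mulN1r//;
        exact: cts_T.
    + exact: ctsZ.
    + by apply: ctsZ; exact: cts_T.
  by apply/funext => y; rewrite mulN1r.
Qed.

End resolvent.
End measure.

(** * The jump function *)

(** The real part of [sigma]. *)
Definition rsigma x : R :=
  if x < 0 then - 2^-1 else if 0 < x then 2^-1
  else if [exists k, a k == 0] then - 2^-1 else 2^-1.

Lemma rsigma_lt0 x : x < 0 -> rsigma x = - 2^-1.
Proof. by rewrite /rsigma => ->. Qed.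

Lemma rsigma_gt0 x : 0 < x -> rsigma x = 2^-1.
Proof. by move=> x0; rewrite /rsigma x0 ltNge ltW. Qed.

Lemma rsigma_homo : {homo rsigma : x y / x <= y}.
Proof.
move=> x y xy; rewrite /rsigma; case: ltgtP => x0; case: ltgtP => y0; try lra.
all: by case: ifP => _; lra.
Qed.

(** The value of [rsigma] at 0 makes the jump visible also when 0 is an endpoint
    of its component. *)
Lemma rsigma_jump : K 0 -> \sum_(k < n) (rsigma (b k) - rsigma (a k)) = 1.
Proof.
move=> /DeltaP[k /andP[ak bk]]; have [_ sep] := ord_ab.
rewrite (bigD1 k)//= big1 ?addr0 => [|j jk]; last first.
  have := ab j => abj.
  have [jk'|kj|/val_inj jk'] := ltngtP j k; last by rewrite jk' eqxx in jk.
    by have := sep _ _ jk' => h; rewrite !rsigma_lt0 ?subrr//; lra.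
  by have := sep _ _ kj => h; rewrite !rsigma_gt0 ?subrr//; lra.
have -> : rsigma (a k) = - 2^-1.
  rewrite /rsigma; case: ltgtP ak => // a0 _; rewrite ifT//.
  by apply/existsP; exists k; rewrite -a0.
have -> : rsigma (b k) = 2^-1.
  rewrite /rsigma; case: ltgtP bk => // b0 _; rewrite ifF//.
  apply/negbTE/existsP => -[j /eqP aj0].
  have := ab j => abj; have := ab k => abk.
  have [jk'|kj|/val_inj jk'] := ltngtP j k.
  - by have := sep _ _ jk'; lra.
  - by have := sep _ _ kj; lra.
  - by move: aj0; rewrite jk'; lra.
by field.
Qed.

(** The indefinite integral is u 0 * rsigma: an interval ]x, y] over which
    rsigma grows contains 0 in its closure, so that the tag is close to 0. *)
Lemma rint_Delta_rsigma u : K 0 -> cts u -> rint_Delta u rsigma = u 0.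
Proof.
move=> K0 cu; rewrite -[RHS]mulr1 -(rsigma_jump K0) mulr_sumr.
apply: eq_bigr => k _; apply: cvg_rint => //; rewrite mulrBr.
apply: (@rsum_cvg _ _ _ (fun x => u 0 * rsigma x) rsigma) => e e0.
have [d d0 ud] := compact_unif_continuous compact_Delta cu e0.
exists d => // x y t ax xt ty yb yxd.
rewrite -mulrBr -mulrBl normrM.
have xy : rsigma x <= rsigma y by apply: rsigma_homo; lra.
rewrite [X in _ * X]ger0_norm ?subr_ge0//.
have [->|sxy] := eqVneq (rsigma x) (rsigma y); first by rewrite subrr !mulr0.
rewrite ler_wpM2r ?subr_ge0//; apply/ltW/ud => //.
  by apply: (@Delta_itv k); apply/andP; split; lra.
have x0 : x <= 0.
  by rewrite leNgt; apply: contra sxy => x0; rewrite !rsigma_gt0//; lra.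
have y0 : 0 <= y.
  by rewrite leNgt; apply: contra sxy => y0; rewrite !rsigma_lt0//; lra.
by rewrite subr0 ltr_norml; apply/andP; split; lra.
Qed.

End real_delta.

(** * Real and imaginary parts *)

Local Notation cRe := (@complex.Re _).
Local Notation cIm := (@complex.Im _).

Section modulus.
Context {R : realType}.
Implicit Types (z w : cplx R).

Lemma modc_norm z : `|z| = (modc z)%:C.
Proof. by []. Qed.

Lemma Re_le_modc z : `|cRe z| <= modc z.
Proof.
case: z => x y; rewrite /modc /= -sqrtr_sqr ler_sqrt ?addr_ge0 ?sqr_ge0//.
by rewrite lerDl sqr_ge0.
Qed.

Lemma Im_le_modc z : `|cIm z| <= modc z.
Proof.
case: z => x y; rewrite /modc /= -sqrtr_sqr ler_sqrt ?addr_ge0 ?sqr_ge0//.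
by rewrite lerDr sqr_ge0.
Qed.

Lemma modc_le z : modc z <= `|cRe z| + `|cIm z|.
Proof.
case: z => x y; rewrite /modc /=.
rewrite -[leRHS]ger0_norm ?addr_ge0// -sqrtr_sqr ler_sqrt ?sqr_ge0//.
rewrite sqrrD !real_normK ?num_real// addrAC lerDl.
by rewrite mulrn_wge0// mulr_ge0.
Qed.

Lemma ReB z w : cRe (z - w) = cRe z - cRe w.
Proof. by case: z; case: w. Qed.

Lemma ImB z w : cIm (z - w) = cIm z - cIm w.
Proof. by case: z; case: w. Qed.

Lemma ReM z w : cRe (z * w) = cRe z * cRe w - cIm z * cIm w.
Proof. by case: z; case: w. Qed.

Lemma ImM z w : cIm (z * w) = cRe z * cIm w + cIm z * cRe w.
Proof. by case: z => ? ?; case: w => ? ? /=. Qed.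

Lemma cvg_cplxP (T : Type) (F : set_system T) (FF : Filter F) (f : T -> cplx R)
    (l : cplx R) :
  f @ F --> l <->
  (cRe \o f @ F --> cRe l) /\ (cIm \o f @ F --> cIm l).
Proof.
split=> [/cvgrPdist_lt fl|[/cvgrPdist_lt fr /cvgrPdist_lt fi]].
  split; apply/cvgrPdist_lt => e e0.
    have /fl : (0 : R[i]) < e%:C by rewrite ltcR.
    apply: filterS => x; rewrite modc_norm ltcR /= -ReB.
    exact/le_lt_trans/Re_le_modc.
  have /fl : (0 : R[i]) < e%:C by rewrite ltcR.
  apply: filterS => x; rewrite modc_norm ltcR /= -ImB.
  exact/le_lt_trans/Im_le_modc.
apply/cvgrPdist_lt => e; rewrite ltcE /= => /andP[/eqP e1 e0].
have e20 : 0 < cRe e / 2 by rewrite divr_gt0.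
apply: filterS (filterI (fr _ e20) (fi _ e20)) => x [/= h1 h2].
have -> : e = (cRe e)%:C by case: e e1 {e0 e20 h1 h2} => ? ? /= ->.
rewrite modc_norm ltcR (le_lt_trans (modc_le _))// ReB ImB; lra.
Qed.

Lemma D_DeltaP n (a b : 'I_n -> R) f : D_Delta a b f <->
  {within Delta a b, continuous (cRe \o f)} /\
  {within Delta a b, continuous (cIm \o f)}.
Proof.
rewrite /D_Delta /=; split=> [cf|[c1 c2]].
  by split=> x; have /cvg_cplxP[] := cf x.
by move=> x; apply/cvg_cplxP; split; [exact: c1|exact: c2].
Qed.

End modulus.

Section complex_rs.
Context {R : realType}.
Implicit Types (f g : R -> cplx R) (a b : R).


Lemma rs_sumE f g a b p : rs_sum f g a b p.1 p.2 =
  (rsum (cRe \o f) (cRe \o g) a b p - rsum (cIm \o f) (cIm \o g) a b p) +i*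
  (rsum (cRe \o f) (cIm \o g) a b p + rsum (cIm \o f) (cRe \o g) a b p).
Proof.
have reE z : z = (cRe z +i* cIm z) :> R[i] by case: z.
have sumRe (I : Type) (r : seq I) (F : I -> R[i]) :
    cRe (\sum_(i <- r) F i) = \sum_(i <- r) cRe (F i).
  by apply: (big_morph (@complex.Re R)) => // -[? ?] [? ?].
have sumIm (I : Type) (r : seq I) (F : I -> R[i]) :
    cIm (\sum_(i <- r) F i) = \sum_(i <- r) cIm (F i).
  by apply: (big_morph (@complex.Im R)) => // -[? ?] [? ?].
rewrite [LHS]reE /rs_sum sumRe sumIm /rsum -sumrB -big_split; congr (_ +i* _).
  by apply: eq_bigr => i _; rewrite ReM ReB ImB.
by apply: eq_bigr => i _; rewrite ImM ReB ImB.
Qed.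

Lemma is_RSP f g a b l :
  is_RS f g a b l <-> rs_sum f g a b p.1 p.2 @[p --> partitions a b] --> l.
Proof.
split=> [h|/cvgrPdist_lt h].
  apply/cvgrPdist_lt => e; rewrite ltcE /= => /andP[/eqP e1 e0].
  have [d d0 hd] := h _ e0; exists d => // -[s xi] /= [tp me].
  have -> : e = (cRe e)%:C by case: e e1 {e0 hd} => ? ? /= ->.
  by rewrite distrC modc_norm ltcR; exact: hd.
move=> e e0; have /h [d d0 hd] : (0 : R[i]) < e%:C by rewrite ltcR.
exists d => // s xi tp me.
by have := hd (s, xi) (conj tp me); rewrite /= distrC modc_norm ltcR.
Qed.

Lemma RSintE f g a b : a < b ->
  {within `[a, b], continuous (cRe \o f)} ->
  {within `[a, b], continuous (cIm \o f)} ->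
  bounded_variation a b (cRe \o g) -> bounded_variation a b (cIm \o g) ->
  RSint f g a b =
    (rint (cRe \o f) (cRe \o g) a b - rint (cIm \o f) (cIm \o g) a b) +i*
    (rint (cRe \o f) (cIm \o g) a b + rint (cIm \o f) (cRe \o g) a b).
Proof.
move=> ab cr ci br bi; have ? := partitions_proper ab.
set l := (X in _ = X).
have hl : is_RS f g a b l.
  apply/is_RSP; rewrite (funext (@rs_sumE f g a b)).
  apply/cvg_cplxP; split.
    exact: (cvgB (bounded_variation_rs_integrable ab cr br)
                 (bounded_variation_rs_integrable ab ci bi)).
  exact: (cvgD (bounded_variation_rs_integrable ab cr bi)
               (bounded_variation_rs_integrable ab ci br)).
have /is_RSP h : is_RS f g a b (RSint f g a b).
  exact: (xgetPex 0 (ex_intro _ l hl)).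
by move/is_RSP : hl; exact: (cvg_unique (@norm_hausdorff _ (cplx R))) h.
Qed.

End complex_rs.

(** * The operators B, its adjoint, and the function Psi *)

Section complex_delta.
Context {R : realType} {n : nat}.
Variables (a b : 'I_n -> R).
Hypothesis ord_ab : ordered_endpoints a b.
Implicit Types (f g : R -> cplx R) (u v m : R -> R) (x y : R).

Notation K := (Delta a b).
Notation cts u := {within K, continuous u}.
Notation J := (rint_Delta a b).

Let ab k : a k < b k. Proof. by case: ord_ab. Qed.

Lemma DstarP g :
  Dstar a b g <-> bv_Delta a b (cRe \o g) /\ bv_Delta a b (cIm \o g).
Proof.
by split=> [h|[h1 h2] k]; [split=> k; case: (h k)|split; [exact: h1|exact: h2]].
Qed.

Lemma sum_cplx (I : Type) (r : seq I) (F G : I -> R) :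
  \sum_(i <- r) (F i +i* G i : R[i]) =
  (\sum_(i <- r) F i) +i* (\sum_(i <- r) G i).
Proof.
by elim: r => [|i r ih]; rewrite ?big_nil// !big_cons ih.
Qed.

Lemma RS_DeltaE f g : D_Delta a b f -> Dstar a b g ->
  RS_Delta a b f g =
    (J (cRe \o f) (cRe \o g) - J (cIm \o f) (cIm \o g)) +i*
    (J (cRe \o f) (cIm \o g) + J (cIm \o f) (cRe \o g)).
Proof.
move=> /D_DeltaP[cr ci] /DstarP[br bi].
rewrite /RS_Delta /rint_Delta -sumrB -big_split -sum_cplx.
by apply: eq_bigr => k _; apply: RSintE => //; exact: cts_component.
Qed.

Lemma pairingE f g : D_Delta a b f -> Dstar a b g ->
  pairing a b f g =
    (J (cRe \o f) (cRe \o g) + J (cIm \o f) (cIm \o g)) +i*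
    (J (cIm \o f) (cRe \o g) - J (cRe \o f) (cIm \o g)).
Proof.
move=> Df /[dup] Dg /DstarP[br bi]; have /D_DeltaP[cr ci] := Df.
have rE : cRe \o (fun x => (g x)^*) = cRe \o g.
  by apply/funext => x /=; case: (g x).
have iE : cIm \o (fun x => (g x)^*) = fun x => -1 * (cIm \o g) x.
  by apply/funext => x /=; rewrite mulN1r; case: (g x).
rewrite /pairing RS_DeltaE//; last first.
  by apply/DstarP; rewrite rE iE; split=> //; exact: bv_DeltaZ.
rewrite rE iE !rint_DeltaZr// !mulN1r opprK; congr (_ +i* _); exact: addrC.
Qed.

Lemma rint_Delta0 m : bv_Delta a b m -> J (fun=> 0) m = 0.
Proof.
move=> bm; have := rint_DeltaZl ord_ab 0 (@cts_cst _ K 0) bm; by rewrite !mul0r.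
Qed.

Lemma rint_Delta0r u : cts u -> J u (fun=> 0) = 0.
Proof.
move=> cu; have bv0 : bv_Delta a b (fun=> 0) by exact: homo_bv_Delta.
have := rint_DeltaZr ord_ab 0 cu bv0; by rewrite !mul0r.
Qed.

Lemma D_Delta_real u : cts u -> D_Delta a b (fun x => (u x)%:C).
Proof. by move=> cu; apply/D_DeltaP; split=> //; exact: cts_cst. Qed.

Lemma pairing_real u g : cts u -> Dstar a b g ->
  pairing a b (fun x => (u x)%:C) g = J u (cRe \o g) +i* - J u (cIm \o g).
Proof.
move=> cu /[dup] Dg /DstarP[br bi].
rewrite pairingE//; last exact: D_Delta_real.
rewrite (_ : cRe \o _ = u)// (_ : cIm \o _ = fun=> 0)//.
by rewrite !rint_Delta0// addr0 sub0r.
Qed.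

(** Real test functions suffice to compare elements of the conjugate space. *)
Lemma Dstar_eqP g h : Dstar a b g -> Dstar a b h ->
  Dstar_eq a b g h <-> forall u, cts u ->
    J u (cRe \o g) = J u (cRe \o h) /\ J u (cIm \o g) = J u (cIm \o h).
Proof.
move=> Dg Dh; split=> [gh u cu|H f Df].
  have := gh _ (D_Delta_real cu); rewrite !pairing_real// => -[-> /eqP].
  by rewrite eqr_opp => /eqP ->.
have /D_DeltaP[cr ci] := Df.
have [h1 h2] := H _ cr; have [h3 h4] := H _ ci.
by rewrite !pairingE// h1 h2 h3 h4.
Qed.

Lemma Re_divr (z : R[i]) (t : R) : cRe (z / t%:C) = cRe z / t.
Proof. by rewrite -fmorphV; case: z => x y /=; rewrite mulr0 subr0. Qed.

Lemma Im_divr (z : R[i]) (t : R) : cIm (z / t%:C) = cIm z / t.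
Proof. by rewrite -fmorphV; case: z => x y /=; rewrite mulr0 add0r. Qed.

Lemma difference_quotient_cvg (u : R -> R) (x l : R) :
  (u y - u x) / (y - x) @[y --> within K x^'] --> l ->
  u @ within K (nbhs x) --> u x.
Proof.
move=> /cvgrPdist_lt/(_ 1 ltr01).
rewrite near_withinE /dnbhs near_withinE => ql.
apply/cvgrPdist_lt => e e0; rewrite near_withinE.
have l0 : 0 < `|l| + 1 by rewrite ltr_wpDl.
have near_x : \forall y \near x, `|x - y| < e / (`|l| + 1).
  by exists (e / (`|l| + 1)) => //=; rewrite divr_gt0.
apply: filterS (filterI ql near_x) => y [/= qy xy] Ky.
have [->|yx] := eqVneq y x; first by rewrite subrr normr0.
have {}qy := qy yx Ky.
have yx0 : y - x != 0 by rewrite subr_eq0.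
rewrite distrC -[u y - u x](divfK yx0) normrM.
rewrite distrC ltr_pdivlMr// in xy.
apply: le_lt_trans xy; rewrite mulrC ler_wpM2l//.
rewrite -[X in `|X|](subrK l) addrC (le_trans (ler_normD _ _))// lerD2l.
by rewrite distrC ltW.
Qed.

(** A function that is differentiable on Delta is continuous there. *)
Lemma C_Delta_continuous p f : C_Delta a b p f -> D_Delta a b f.
Proof.
move=> [g1 [h [df _ _ _]]]; apply/D_DeltaP.
split; apply/subspace_continuousP => x Kx;
  have /cvg_cplxP[h1 h2] := df x Kx.
  apply: (@difference_quotient_cvg _ _ (cRe (g1 x))).
  by under eq_fun do rewrite -ReB -Re_divr.
apply: (@difference_quotient_cvg _ _ (cIm (g1 x))).
by under eq_fun do rewrite -ImB -Im_divr.
Qed.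

Section measure.
Variable nu : {measure set R -> \bar R}.
Hypothesis nu_fin : fin_num_fun nu.
Hypothesis nu_pt : forall x, nu [set x] = 0%E.
Hypothesis normT : (opnorm a b (opT a b nu) < (Omega nu)%:E)%E.

Notation T := (truncT nu K).
Notation Om := (Omega nu).

Lemma opT_Re f x : cRe (opT a b nu f x) = T (cRe \o f) x.
Proof.
rewrite /opT /cintegral /= Rintegral_mkcond /truncT /correl.
by congr Rintegral; apply/funext => w; rewrite !patchE.
Qed.

Lemma opT_Im f x : cIm (opT a b nu f x) = T (cIm \o f) x.
Proof.
rewrite /opT /cintegral /= Rintegral_mkcond /truncT /correl.
by congr Rintegral; apply/funext => w; rewrite !patchE.
Qed.

Lemma opL_Re f x : cRe (opL a b nu f x) = T (cRe \o f) x - Om * cRe (f x).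
Proof.
rewrite -opT_Re /opL; case: (opT _ _ _ _ _) => ? ?; case: (f x) => ? ? /=; ring.
Qed.

Lemma opL_Im f x : cIm (opL a b nu f x) = T (cIm \o f) x - Om * cIm (f x).
Proof.
rewrite -opT_Im /opL; case: (opT _ _ _ _ _) => ? ?; case: (f x) => ? ? /=; ring.
Qed.

(** The constant 1 lies in the unit ball, so (T 1)(x) = nu(Delta - x) is at most
    the norm of T. *)
Lemma truncT1_bound : K 0 -> exists2 q, 0 <= q < Om &
  forall x, K x -> T (fun=> 1) x <= q.
Proof.
move=> K0; pose N := opnorm a b (opT a b nu).
have one : (D_Delta a b `&` [set f | (supnorm a b f <= 1)%E]) (fun=> 1).
  split; first exact: D_Delta_real (@cts_cst _ K 1).
  apply: ge_ereal_sup => _ [x _ <-]; rewrite lee_fin /modc /=.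
  by rewrite expr1n expr0n/= addr0 sqrtr1.
have TN x : K x -> (`|T (fun=> 1) x|%:E <= N)%E.
  move=> Kx.
  apply: (@le_trans _ _ (supnorm a b (opT a b nu (fun=> 1)))); last first.
    by apply: ereal_sup_ubound; exists (fun=> 1).
  apply: (@le_trans _ _ (modc (opT a b nu (fun=> 1) x))%:E); last first.
    by apply: ereal_sup_ubound; exists x.
  by rewrite lee_fin (le_trans _ (Re_le_modc _))// opT_Re.
have N0 : (0 <= N)%E by apply: le_trans (TN 0 K0); rewrite lee_fin.
have Nfin : N \is a fin_num by rewrite ge0_fin_numE// (lt_trans normT)// ltry.
exists (fine N); first by rewrite fine_ge0//= -lte_fin fineK.
move=> x Kx; rewrite (le_trans (ler_norm _))// -lee_fin fineK//; exact: TN.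
Qed.

Let cK : compact K. Proof. exact: compact_Delta. Qed.
Let frK := @Delta_frontier _ _ a b.

Section resolvents.
Variable q : R.
Hypothesis q_ge0 : 0 <= q.
Hypothesis ltq : q < Om.
Hypothesis T1 : forall x, K x -> T (fun=> 1) x <= q.

Lemma opB_spec f : D_Delta a b f -> D_Delta a b (opB a b nu f) /\
  forall x, K x -> opL a b nu (opB a b nu f) x = - f x.
Proof.
move=> /D_DeltaP[cr ci].
have [crr rr] := resolventP nu_fin nu_pt q_ge0 T1 ltq cr.
have [cri ri] := resolventP nu_fin nu_pt q_ge0 T1 ltq ci.
set ur := resolvent _ _ _ _ _ in crr rr.
set ui := resolvent _ _ _ _ _ in cri ri.
apply: (@xgetPex _ (fun=> 0) [set h | D_Delta a b h /\
  forall x, K x -> opL a b nu h x = - f x]).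
exists (fun x => ur x +i* ui x); split; first by apply/D_DeltaP.
move=> x Kx; have hr := rr x Kx; have hi := ri x Kx; rewrite /= in hr hi.
have reE (z : R[i]) : z = cRe z +i* cIm z by case: z.
rewrite [LHS]reE opL_Re opL_Im [f x]reE -hr -hi.
rewrite (_ : cRe \o _ = ur)// (_ : cIm \o _ = ui)//=.
by congr (_ +i* _); rewrite opprB.
Qed.

Lemma opB_comp f (w1 w2 : R -> R) : cts w1 -> cts w2 ->
  D_Delta a b f ->
  (forall x, K x -> Om * w1 x - T w1 x = cRe (f x)) ->
  (forall x, K x -> Om * w2 x - T w2 x = cIm (f x)) ->
  forall x, K x -> opB a b nu f x = w1 x +i* w2 x.
Proof.
move=> c1 c2 /opB_spec[/D_DeltaP[cr ci] hB] h1 h2 x Kx.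
have uniq := resolvent_uniq nu_fin cK frK T1 ltq.
have reE (z : R[i]) : z = cRe z +i* cIm z by case: z.
rewrite [LHS]reE; congr (_ +i* _).
  apply: (uniq _ _ cr c1) => // y Ky; rewrite h1//.
  have /(congr1 cRe) := hB y Ky; rewrite opL_Re.
  by case: (f y) => ? ? /= H; apply/eqP; rewrite -eqr_opp opprB -H.
apply: (uniq _ _ ci c2) => // y Ky; rewrite h2//.
have /(congr1 cIm) := hB y Ky; rewrite opL_Im.
by case: (f y) => ? ? /= H; apply/eqP; rewrite -eqr_opp opprB -H.
Qed.

Let ctsL lam u : cts u -> cts (fun x => lam * u x - T u x).
Proof. by move=> cu; have := cts_lamBT nu_fin nu_pt (lam := lam) cu. Qed.

(** The identity (f, B^* g) = (B f, g) for f = (Om - T) u and B f = u; as the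
    kernel is real, it splits into real and imaginary parts. *)
Lemma Bstar_spec g : Dstar a b g -> Dstar a b (Bstar a b nu g) /\
  forall u, cts u ->
    J (fun x => Om * u x - T u x) (cRe \o Bstar a b nu g) = J u (cRe \o g) /\
    J (fun x => Om * u x - T u x) (cIm \o Bstar a b nu g) = J u (cIm \o g).
Proof.
move=> /[dup] Dg /DstarP[br bi].
have [mr bmr mrE] := resolvent_adjoint_ex ord_ab nu_fin nu_pt q_ge0 T1 ltq br.
have [mi bmi miE] := resolvent_adjoint_ex ord_ab nu_fin nu_pt q_ge0 T1 ltq bi.
have [Dk kE] : Dstar a b (Bstar a b nu g) /\ forall f, D_Delta a b f ->
    pairing a b f (Bstar a b nu g) = pairing a b (opB a b nu f) g.
  apply: (@xgetPex _ (fun=> 0) [set h | Dstar a b h /\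
    forall f, D_Delta a b f ->
      pairing a b f h = pairing a b (opB a b nu f) g]).
  exists (fun x => mr x +i* mi x); split; first exact/DstarP.
  move=> f Df; have [DB hB] := opB_spec Df.
  have /D_DeltaP[cr ci] := Df; have /D_DeltaP[cBr cBi] := DB.
  have Dm : Dstar a b (fun x => mr x +i* mi x) by exact/DstarP.
  rewrite !pairingE//.
  rewrite (_ : cRe \o (fun x => _ +i* _) = mr)//.
  rewrite (_ : cIm \o (fun x => _ +i* _) = mi)//.
  have er x : K x -> (cRe \o f) x =
      Om * (cRe \o opB a b nu f) x - T (cRe \o opB a b nu f) x.
    move=> Kx; have /(congr1 cRe) := hB x Kx; rewrite opL_Re /=.
    by case: (f x) => ? ? /= H; apply/eqP; rewrite -eqr_opp opprB -H.
  have ei x : K x -> (cIm \o f) x =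
      Om * (cIm \o opB a b nu f) x - T (cIm \o opB a b nu f) x.
    move=> Kx; have /(congr1 cIm) := hB x Kx; rewrite opL_Im /=.
    by case: (f x) => ? ? /= H; apply/eqP; rewrite -eqr_opp opprB -H.
  rewrite !(eq_rint_Delta ord_ab cr _ er)// !(eq_rint_Delta ord_ab ci _ ei)//.
  by rewrite !mrE// !miE.
split=> // u cu; set w := fun x => _.
have cw : cts w by exact: ctsL.
have := kE _ (D_Delta_real cw); rewrite pairing_real//.
have uE x : K x -> (u x)%:C = opB a b nu (fun x => (w x)%:C) x.
  move=> Kx.
  rewrite (@opB_comp _ u (fun=> 0))//; [exact: cts_cst|exact: D_Delta_real|].
  move=> y Ky /=; rewrite mulr0 sub0r.
  have := truncTZ nu_fin cK frK 0 y (@cts_cst _ K 0).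
  by rewrite !mul0r => ->; rewrite oppr0.
have [DB _] := opB_spec (D_Delta_real cw); have /D_DeltaP[cBr cBi] := DB.
rewrite pairingE//.
have ur x : K x -> (cRe \o opB a b nu (fun x => (w x)%:C)) x = u x.
  by move=> Kx /=; rewrite -uE.
have ui x : K x -> (cIm \o opB a b nu (fun x => (w x)%:C)) x = 0.
  by move=> Kx /=; rewrite -uE.
rewrite !(eq_rint_Delta ord_ab cBr _ ur)// !(eq_rint_Delta ord_ab cBi _ ui)//.
rewrite !rint_Delta0// addr0 sub0r => -[-> /eqP].
by rewrite eqr_opp => /eqP ->.
Qed.

Lemma Re_sigma : cRe \o sigma a = rsigma a.
Proof.
apply/funext => x; rewrite /sigma /rsigma /=.
by case: ifP => // _; case: ifP => // _; case: ifP.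
Qed.

Lemma Im_sigma : cIm \o sigma a = fun=> 0.
Proof.
apply/funext => x; rewrite /sigma /=.
by case: ifP => // _; case: ifP => // _; case: ifP.
Qed.

Lemma Dstar_sigma : Dstar a b (sigma a).
Proof.
apply/DstarP; rewrite Re_sigma Im_sigma; split; last exact: homo_bv_Delta.
by apply: homo_bv_Delta; exact: rsigma_homo.
Qed.

Hypothesis K0 : K 0.

Lemma Phi0_spec : Dstar a b (Phi0 a b nu) /\
  forall u, cts u ->
    J (fun x => Om * u x - T u x) (cRe \o Phi0 a b nu) = u 0 /\
    J (fun x => Om * u x - T u x) (cIm \o Phi0 a b nu) = 0.
Proof.
have [DPhi PhiE] := Bstar_spec Dstar_sigma; split=> // u cu.
have [-> ->] := PhiE u cu.
by rewrite Re_sigma Im_sigma (rint_Delta_rsigma ord_ab)// rint_Delta0r.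
Qed.

Variable s : R.

Lemma Dstar_add_scale g h : Dstar a b g -> Dstar a b h ->
  Dstar a b (fun x => g x + s%:C * h x) /\
  forall u, cts u ->
    J u (cRe \o (fun x => g x + s%:C * h x)) =
      J u (cRe \o g) + s * J u (cRe \o h) /\
    J u (cIm \o (fun x => g x + s%:C * h x)) =
      J u (cIm \o g) + s * J u (cIm \o h).
Proof.
move=> /DstarP[gr gi] /DstarP[hr hi].
have rE : cRe \o (fun x => g x + s%:C * h x) =
    fun x => (cRe \o g) x + s * (cRe \o h) x.
  by apply/funext => x /=; case: (g x) => ? ?; case: (h x) => ? ? /=; ring.
have iE : cIm \o (fun x => g x + s%:C * h x) =
    fun x => (cIm \o g) x + s * (cIm \o h) x.
  by apply/funext => x /=; case: (g x) => ? ?; case: (h x) => ? ? /=; ring.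
split.
  apply/DstarP; rewrite rE iE.
  by split; apply: bv_DeltaD => //; exact: bv_DeltaZ.
move=> u cu; rewrite rE iE; split.
  by rewrite (rint_DeltaDr ord_ab cu gr (bv_DeltaZ s hr)) (rint_DeltaZr ord_ab).
by rewrite (rint_DeltaDr ord_ab cu gi (bv_DeltaZ s hi)) (rint_DeltaZr ord_ab).
Qed.

(** Paired with (Om - T) u, the function g + s B^* g gives the integral of
    (Om - T) u + s u against dg, and Phi0 gives u(0). Conversely the functions
    (Om - T) u exhaust the continuous functions, by [resolventP]. *)
Lemma Psi_eqP g : Dstar a b g ->
  Dstar_eq a b (fun x => g x + s%:C * Bstar a b nu g x) (Phi0 a b nu) <->
  forall u, cts u ->
    J (fun x => (Om + s) * u x - T u x) (cRe \o g) = u 0 /\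
    J (fun x => (Om + s) * u x - T u x) (cIm \o g) = 0.
Proof.
move=> Dg; have [DB BE] := Bstar_spec Dg; have [DP PE] := Phi0_spec.
have [Dgs gsE] := Dstar_add_scale Dg DB; have /DstarP[br bi] := Dg.
have shiftJ w m : cts w -> bv_Delta a b m ->
    J (fun x => Om * w x - T w x) m + s * J w m =
    J (fun x => (Om + s) * w x - T w x) m.
  move=> cw bm; rewrite -(rint_DeltaZl ord_ab s cw bm).
  rewrite -(rint_DeltaDl ord_ab (@ctsL Om _ cw) (ctsZ (a := s) cw) bm).
  by congr rint_Delta; apply/funext => x; ring.
have E w : cts w -> let L := fun x => Om * w x - T w x in
    (J L (cRe \o (fun x => g x + s%:C * Bstar a b nu g x)) =
       J L (cRe \o Phi0 a b nu) /\
     J L (cIm \o (fun x => g x + s%:C * Bstar a b nu g x)) =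
       J L (cIm \o Phi0 a b nu)) <->
    (J (fun x => (Om + s) * w x - T w x) (cRe \o g) = w 0 /\
     J (fun x => (Om + s) * w x - T w x) (cIm \o g) = 0).
  move=> cw L; have [-> ->] := gsE _ (@ctsL Om _ cw).
  have [-> ->] := BE w cw; have [-> ->] := PE w cw.
  by rewrite !shiftJ.
rewrite (Dstar_eqP Dgs DP); split=> H u cu; first by apply/(E _ cu)/H/ctsL.
have [] := resolventP nu_fin nu_pt q_ge0 T1 ltq cu.
set w := resolvent _ _ _ _ _ => cw wE; have /(E _ cw) := H _ cw.
have Jw m : bv_Delta a b m -> J (fun x => Om * w x - T w x) m = J u m.
  by move=> bm; apply: (eq_rint_Delta ord_ab (@ctsL Om _ cw) bm wE).
have /DstarP[? ?] := Dgs; have /DstarP[? ?] := DP.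
by rewrite !Jw.
Qed.

Hypothesis s_gt0 : 0 < s.

(** Existence comes from the adjoint of the resolvent at Om + s, applied to
    [rsigma]. *)
Lemma Psi_spec : Dstar a b (Psi a b nu s) /\ forall u, cts u ->
    J (fun x => (Om + s) * u x - T u x) (cRe \o Psi a b nu s) = u 0 /\
    J (fun x => (Om + s) * u x - T u x) (cIm \o Psi a b nu s) = 0.
Proof.
have ltqs : q < Om + s by rewrite ltr_wpDr// ltW.
have [m bm mE] := resolvent_adjoint_ex ord_ab nu_fin nu_pt q_ge0 T1 ltqs
  (homo_bv_Delta a b (@rsigma_homo _ _ a)).
have [DPsi] : Dstar a b (Psi a b nu s) /\ Dstar_eq a b
    (fun x => Psi a b nu s x + s%:C * Bstar a b nu (Psi a b nu s) x)
    (Phi0 a b nu).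
  apply: (@xgetPex _ (fun=> 0) [set g | Dstar a b g /\
    Dstar_eq a b (fun x => g x + s%:C * Bstar a b nu g x) (Phi0 a b nu)]).
  have Dm : Dstar a b (fun x => (m x)%:C).
    by apply/DstarP; split=> //; exact: homo_bv_Delta.
  exists (fun x => (m x)%:C); split=> //; apply/(Psi_eqP Dm) => u cu.
  split; first by rewrite mE// (rint_Delta_rsigma ord_ab).
  rewrite -[RHS](@rint_Delta0r (fun x => (Om + s) * u x - T u x))//.
  exact: ctsL.
by move/(Psi_eqP DPsi).
Qed.

End resolvents.
End measure.
End complex_delta.

(** * The theorem *)

Theorem theorem4p10 (R : realType)
    (d : measure_display) (W : measurableType d) (P : probability W R)
    (X : R -> {RV P >-> R})
    (A gamma : R) (nu : {measure set R -> \bar R})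
    (n : nat) (a b : 'I_n -> R) (p s : R) :
  is_levy_process X ->
  has_triplet X A gamma nu ->
  type_Ic A nu ->
  gamma = \int[nu]_(y in [set y : R | `|y| < 1]) y ->
  ordered_endpoints a b ->
  (opnorm a b (opT a b nu) < (Omega nu)%:E)%E ->
  Delta a b 0 ->
  1 < p ->
  0 < s ->
  forall f : R -> R[i]^o, C_Delta a b p f ->
    RS_Delta a b (fun x => s%:C * f x - opL a b nu f x) (Psi a b nu s) = f 0.
Proof.
move=> _ _ [_ nu_fin nu_pt] _ ord_ab normT K0 _ s0 f /C_Delta_continuous Df.
have [q /andP[q0 qOm] T1] := truncT1_bound normT K0.
have [DPsi PsiE] := Psi_spec ord_ab nu_fin nu_pt q0 qOm T1 K0 s0.
have /D_DeltaP[cr ci] := Df.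
set F := fun x => _.
pose L u x := (Omega nu + s) * u x - truncT nu (Delta a b) u x.
have rE : cRe \o F = L (cRe \o f).
  apply/funext => x; rewrite /F /L /= ReB opL_Re.
  by case: (f x) => ? ? /=; ring.
have iE : cIm \o F = L (cIm \o f).
  apply/funext => x; rewrite /F /L /= ImB opL_Im.
  by case: (f x) => ? ? /=; ring.
have cL u : {within Delta a b, continuous u} ->
    {within Delta a b, continuous (L u)}.
  by move=> cu; have := cts_lamBT nu_fin nu_pt (lam := Omega nu + s) cu.
have DF : D_Delta a b F by apply/D_DeltaP; rewrite rE iE; split; exact: cL.
rewrite RS_DeltaE// rE iE /L.
have [-> ->] := PsiE _ cr; have [-> ->] := PsiE _ ci.
by rewrite subr0 add0r /=; case: (f 0).
Qed.
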